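(* Let $X$, $T$, $Y$, $\mathbb F^{Y,T}$ and $\tilde{\mathbb G}$ be as defined in the context. Assume that $X_u=\alpha J_u+\beta Z_{J_u}$ has the no arbitrage property with respect to $\mathcal S(\tilde{\mathbb G})$. Then the process $(e^{Y_t})_{t\ge0}$ has the no arbitrage property with respect to $\mathcal S(\mathbb F^{Y,T})$.
   Context: Setting. Let $(\Omega,\mathcal F,\mathbb F,\mathbb P)$ be a filtered probability space, with $\mathbb F=(\mathcal F_t)_{t\ge0}$ satisfying the usual conditions, carrying two independent Brownian motions $B$ and $W$ and an adapted non-decreasing Lévy process $J$ independent of $(B,W)$. For $\rho\in[-1,1]$ let $Z_t:=\rho B_t+\sqrt{1-\rho^2}\,W_t$. Let $\mu,\sigma:[0,\infty)\times\mathbb R\to\mathbb R$ be such that the SDE $$dv_t=\mu(t,v_t)dt+\sigma(t,v_t)dB_t,\quad v_0=1,\qquad dT_t=v_tdt,\quad T_0=0$$ has a unique strong solution, with $v$ nonnegative, $\mathbb E T_t=t$, and $T_t\to\infty$ a.s. as $t\to\infty$. $T$ is continuous and strictly increasing. For real constants $\alpha,\beta$, let $X_t:=\alpha J_t+\beta Z_{J_t}$ and $Y_t:=X_{T_t}$. Filtrations. For processes $U$, $\mathbb F^{U}=(\mathcal F^U_t)_{t\ge 0}$ is the augmented filtration generated by $U$ (and similarly $\mathbb F^{Y,T}$ for the pair $(Y,T)$). Let $C_t:=\inf\{u>0:T_u>t\}$, which is an $\mathbb F^{Y,T}$-stopping time, and $\tilde{\mathbb G}=(\tilde{\mathcal G}_t)_{t\ge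 0}$ with $\tilde{\mathcal G}_t:=\mathcal F^{Y,T}_{C_t}$; $X$ is adapted to $\tilde{\mathbb G}$. Trading strategies. For a filtration $\mathbb H=(\mathcal H_t)_{t\ge0}$, $\mathcal S(\mathbb H)$ is the set of processes $H=g_0\mathbf 1_{\{0\}}+\sum_{j=1}^{n-1}g_j\mathbf 1_{(\tau_j,\tau_{j+1}]}$ with $n\ge2$, $0\le\tau_1\le\dots\le\tau_n$ $\mathbb H$-stopping times, $\tau_n$ bounded, $g_0$ a real number, and $g_j$ an $\mathcal H_{\tau_j}$-measurable random variable. For such $H$ and an $\mathbb H$-adapted process $S$ (not necessarily a semimartingale), $(H\cdot S)_\infty:=\sum_{j=1}^{n-1}g_j(S_{\tau_{j+1}}-S_{\tau_j})$. No arbitrage. An $\mathbb H$-adapted process $S$ has the no arbitrage property with respect to a class $\mathcal X$ of such strategies if $\{(H\cdot S)_\infty:H\in\mathcal X\}\cap L_0^+=\{0\}$, where $L_0^+$ is the set of nonnegative $\mathcal F$-measurable random variables. *)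

(* Defs.v *)
From HB Require Import structures.
From mathcomp Require Export all_boot all_order all_algebra.
From mathcomp Require Export all_classical all_reals all_analysis.

Set Implicit Arguments.
Unset Strict Implicit.
Unset Printing Implicit Defensive.

Export Order.TTheory GRing.Theory Num.Theory.
Export numFieldNormedType.Exports.
#[global] Open Scope classical_set_scope.
#[global] Open Scope ring_scope.

(* Time is the set of t : R with 0 <= t; the value of a process or of a
   filtration at a negative time is irrelevant.  Path properties are required
   almost surely. *)

Section Filtrations.
Context (d : measure_display) (Omega : measurableType d) (R : realType).
Implicit Types (P : probability Omega R) (H : R -> set (set Omega)).
Implicit Types (U : R -> Omega -> R) (tau : Omega -> \bar R).

Definition filtration H : Prop :=
  [/\ forall t, 0 <= t -> sigma_algebra setT (H t),
      forall t, 0 <= t -> H t `<=` measurable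
    & forall s t, 0 <= s -> s <= t -> H s `<=` H t].

(* As [H 0] consists of measurable sets, the first condition also makes the
   probability space complete. *)
Definition usual_conditions P H : Prop :=
  (forall N, P.-negligible N -> H 0 N) /\
  (forall t, 0 <= t -> \bigcap_(s in [set s | t < s]) H s `<=` H t).

Definition measurable_wrt (G : set (set Omega)) (f : Omega -> R) : Prop :=
  forall A : set R, measurable A -> G (f @^-1` A).

Definition adapted H U : Prop := forall t, 0 <= t -> measurable_wrt (H t) (U t).

Definition events_of (f : Omega -> R) : set (set Omega) :=
  [set f @^-1` A | A in measurable].

Definition past_events U (t : R) : set (set Omega) :=
  \bigcup_(s in [set s | 0 <= s <= t]) events_of (U s).

Definition all_events U : set (set Omega) :=
  \bigcup_(s in [set s | 0 <= s]) events_of (U s).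

(* The smallest complete right-continuous filtration containing [Gen]. *)
Definition augmentation P (Gen : R -> set (set Omega)) (t : R) :
    set (set Omega) :=
  \bigcap_(s in [set s | t < s]) <<s Gen s `|` [set N | P.-negligible N] >>.

Definition natural_filtration P U : R -> set (set Omega) :=
  augmentation P (past_events U).

Definition natural_filtration2 P U1 U2 : R -> set (set Omega) :=
  augmentation P (fun t => past_events U1 t `|` past_events U2 t).

Definition stopping_time H tau : Prop :=
  (forall w, (0 <= tau w)%E) /\
  (forall t, 0 <= t -> H t [set w | (tau w <= t%:E)%E]).

Definition stopped_sigma_algebra H tau : set (set Omega) :=
  [set A | measurable A /\
     forall t, 0 <= t -> H t (A `&` [set w | (tau w <= t%:E)%E])].

(* Independence of the sigma-algebras generated by [G1] and [G2]. *)
Definition independent P (G1 G2 : set (set Omega)) : Prop :=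
  forall A1 A2, <<s G1 >> A1 -> <<s G2 >> A2 ->
    P (A1 `&` A2) = (P A1 * P A2)%E.

End Filtrations.

Section Strategies.
Context (d : measure_display) (Omega : measurableType d) (R : realType).
Implicit Types (P : probability Omega R) (H : R -> set (set Omega)).
Implicit Types (S : R -> Omega -> R).

(* The data of g_0 1_{0} + sum_(1 <= j < n) g_j 1_(tau_j, tau_{j+1}]; only
   tau_1, ..., tau_n and g_1, ..., g_{n-1} are relevant. *)
Record strategy := Strategy {
  st_n : nat;
  st_g0 : R;
  st_g : nat -> Omega -> R;
  st_tau : nat -> Omega -> R }.

Definition strategy_process (h : strategy) (t : R) (w : Omega) : R :=
  (if t == 0 then st_g0 h else 0) +
  \sum_(1 <= j < st_n h)
    (if st_tau h j w < t <= st_tau h j.+1 w then st_g h j w else 0).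

Definition simple_strategies H : set strategy :=
  [set h : strategy |
    [/\ (2 <= st_n h)%N,
        forall w, 0 <= st_tau h 1 w /\
          (forall j, (1 <= j < st_n h)%N -> st_tau h j w <= st_tau h j.+1 w),
        exists K : R, forall w, st_tau h (st_n h) w <= K,
        forall j, (1 <= j <= st_n h)%N ->
          stopping_time H (EFin \o st_tau h j)
      & forall j, (1 <= j < st_n h)%N ->
          measurable_wrt (stopped_sigma_algebra H (EFin \o st_tau h j))
            (st_g h j)]].

Definition terminal_gain (h : strategy) S (w : Omega) : R :=
  \sum_(1 <= j < st_n h)
    st_g h j w * (S (st_tau h j.+1 w) w - S (st_tau h j w) w).

Definition gain_process (h : strategy) S (t : R) (w : Omega) : R :=
  \sum_(1 <= j < st_n h) st_g h j w *
    (S (Num.min (st_tau h j.+1 w) t) w - S (Num.min (st_tau h j w) t) w).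

Definition L0_nonneg P : set (Omega -> R) :=
  [set f : Omega -> R | measurable_fun setT f /\ {ae P, forall w, 0 <= f w}].

(* The equality {(H.S)_oo | H in X} `&` L0+ = {0} between sets of random
   variables identified when almost surely equal. *)
Definition no_arbitrage P (S : R -> Omega -> R) (X : set strategy) : Prop :=
  forall f : Omega -> R, L0_nonneg P f ->
    ((exists2 h, X h & {ae P, forall w, terminal_gain h S w = f w}) <->
     {ae P, forall w, f w = 0}).

End Strategies.

Section Processes.
Context (d : measure_display) (Omega : measurableType d) (R : realType).
Implicit Types (P : probability Omega R) (H : R -> set (set Omega)).
Implicit Types (B J v : R -> Omega -> R).

Local Notation leb := (@lebesgue_measure R).

Definition continuous_paths P (U : R -> Omega -> R) : Prop :=
  {ae P, forall w, {within `[0%R, +oo[, continuous (fun t => U t w)}}.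

Definition brownian_motion P H B : Prop :=
  [/\ adapted H B,
      {ae P, forall w, B 0 w = 0},
      continuous_paths P B,
      forall s t, 0 <= s -> s < t ->
        independent P (H s) (events_of (fun w => B t w - B s w))
    & forall s t, 0 <= s -> s < t -> forall A : set R, measurable A ->
        P ((fun w => B t w - B s w) @^-1` A)
        = normal_prob 0 (Num.sqrt (t - s)) A].

(* Increments are independent of the past of [J] itself. *)
Definition levy_process P J : Prop :=
  [/\ {ae P, forall w, J 0 w = 0},
      {ae P, forall w,
        (forall t, 0 <= t -> J x w @[x --> t^'+] --> J t w) /\
        (forall t, 0 < t -> cvg (J x w @[x --> t^'-]))},
      forall s t, 0 <= s -> s < t ->
        independent P (past_events J s)
          (events_of (fun w => J t w - J s w))
    & forall s t, 0 <= s -> s < t -> forall A : set R, measurable A ->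
        P ((fun w => J t w - J s w) @^-1` A) = P (J (t - s) @^-1` A)].

Definition nondecreasing_paths P J : Prop :=
  {ae P, forall (w : Omega) (s t : R), 0 <= s -> s <= t -> J s w <= J t w}.

(* [I] is the Ito integral of [K] with respect to the Brownian motion [B]: a
   limit of integrals of simple processes [h n] such that, for all t,
   int_0^t (h n - K)^2 ds --> 0.  Both convergences usually hold in
   probability; along a subsequence they hold almost surely, uniformly on
   compact time intervals for the integrals. *)
Definition ito_integral P H B (K I : R -> Omega -> R) : Prop :=
  [/\ {ae P, forall (w : Omega) (t : R), 0 <= t ->
        measurable_fun `[0, t] (fun s => K s w) /\
        leb.-integrable `[0, t] (fun s => ((K s w) ^+ 2)%:E)},
      adapted H I,
      continuous_paths P I
    & exists h : nat -> strategy Omega R,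
        (forall n, simple_strategies H (h n)) /\
        {ae P, forall (w : Omega) (t : R), 0 <= t ->
          ((\int[leb]_(s in `[0%R, t])
              ((strategy_process (h n) s w - K s w) ^+ 2)%:E)%E
             @[n --> \oo] --> 0%E) /\
          (forall e, 0 < e -> \forall n \near \oo, forall s, 0 <= s <= t ->
             `|gain_process (h n) B s w - I s w| < e)}].

(* Solution of dv = mu(t, v) dt + sigma(t, v) dB, v_0 = 1. *)
Definition strong_solution P B (mu sigma : R -> R -> R) v : Prop :=
  [/\ adapted (natural_filtration P B) v,
      continuous_paths P v,
      {ae P, forall (w : Omega) (t : R), 0 <= t ->
        leb.-integrable `[0, t] (fun s => (mu s (v s w))%:E)}
    & exists2 I : R -> Omega -> R,
        ito_integral P (natural_filtration P B) B
          (fun s w => sigma s (v s w)) I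
      & {ae P, forall (w : Omega) (t : R), 0 <= t ->
          v t w = 1 + (\int[leb]_(s in `[0, t]) mu s (v s w)) + I t w}].

Definition unique_strong_solution P B (mu sigma : R -> R -> R) v : Prop :=
  strong_solution P B mu sigma v /\
  forall v', strong_solution P B mu sigma v' ->
    {ae P, forall (w : Omega) (t : R), 0 <= t -> v' t w = v t w}.

(* T_t = int_0^t v_s ds *)
Definition time_change v (t : R) (w : Omega) : R :=
  \int[leb]_(s in `[0, t]) v s w.

(* C_t = inf {u > 0 : T_u > t}, which may be +oo *)
Definition inverse_time_change (T : R -> Omega -> R) (t : R) (w : Omega) :
    \bar R :=
  ereal_inf [set u%:E | u in [set u | 0 < u /\ t < T u w]].

Definition correlated (rho : R) B (W : R -> Omega -> R) (t : R) (w : Omega) : R :=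
  rho * B t w + Num.sqrt (1 - rho ^+ 2) * W t w.

Definition subordinated (alpha beta : R) (Z : R -> Omega -> R) J
    (t : R) (w : Omega) : R :=
  alpha * J t w + beta * Z (J t w) w.

Definition time_changed (X T : R -> Omega -> R) (t : R) (w : Omega) : R :=
  X (T t w) w.

(* The filtration t |-> F^{Y,T}_{C_t}. *)
Definition time_changed_filtration P (Y T : R -> Omega -> R) (t : R) :
    set (set Omega) :=
  stopped_sigma_algebra (natural_filtration2 P Y T) (inverse_time_change T t).

End Processes.

(* Main.v *)
Require Import Defs.
From mathcomp Require Import measurable_realfun ring lra.

(* As exp is increasing, and as an arbitrage with simple strategies yields one
   with a single trade, it is enough to consider 1_A eps (Y_sigma - Y_tau) with
   eps = +-1, tau <= sigma <= kap and A in F_tau.  This is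
   1_A eps (X_{T_sigma} - X_{T_tau}), and T_tau, T_sigma are stopping times of
   the time-changed filtration, but T_sigma is in general unbounded, so no
   arbitrage for X only applies to the gain V_N obtained by stopping at a
   constant time N: it gives V_N = 0 as soon as V_N >= 0, and the claim follows
   by letting N tend to infinity.

   That V_N >= 0 for large N uses the structure of the model.  Suppose that
   V_N < - delta on a non-null event.  There the position is still open at time
   N and must recover before T_kap.  Either J_m is below any positive level with
   positive probability, for all m: then J, being independent of (B, W) and of
   its own past, stays almost constant on [N, T_kap] with positive conditional
   probability, and so does X.  Or J_m >= eta > 0 a.s. for some m, hence
   J_N >= kap + 2 a.s. for N large: then T, up to time kap, is independent of
   the increments of B and W that drive X after time N, and these stay with
   positive probability below any given decreasing line.  In this second case
   beta = 0 would make X monotone, so no arbitrage for X forces alpha = 0. *)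

Set Implicit Arguments.
Unset Strict Implicit.
Unset Printing Implicit Defensive.

(** * Path regularity *)

(** Brownian paths are read on two clocks: [T] depends on [B] in calendar time, while [X] reads [B]
    and [W] at the level reached by [J]. The part of [B] beyond the level [J N] may therefore
    already influence [T kap], and this forces the two cases: an almost frozen [J] makes that part
    harmless, a level [J N] above [kap + 2] makes it independent of the clock. The margin 2 is one
    unit for approximating a stopping time by later rational times and one for the right continuity
    of the augmented filtrations.

    Positive conditional probability is used without conditional expectations: a past event that is
    null on an independent event of positive probability is null. The past then needs deterministic
    horizons, so the losing event is cut by countably many parameters (size of the loss, cell of
    [J N], bound on [T kap]) into pieces on which [J N] lies just below a constant [b]. Between
    [J N] and [b] no independence is available; the pieces are so fine that [Z] hardly moves
    there. *)

Section Continuity.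
Context (R : realType).
Implicit Types (f g : R -> R) (s t : R).

Definition right_continuous_at f t := forall e, 0 < e ->
  exists2 d, 0 < d & forall s, t <= s -> s < t + d -> `|f s - f t| < e.

(** Only nonnegative times are compared, the values of a process at negative times being
    arbitrary. *)
Definition continuous_pos f := forall t, 0 <= t -> forall e, 0 < e ->
  exists2 d, 0 < d & forall s, 0 <= s -> `|s - t| < d -> `|f s - f t| < e.

Lemma cvg_right_continuous_at f t :
  f x @[x --> t^'+] --> f t -> right_continuous_at f t.
Proof.
move=> ft e e0.
have /cvgrPdist_lt/(_ _ e0) := ft.
move=> -[d /= d0 H]; exists d => // s ts std.
move: ts; rewrite le_eqVlt => /orP[/eqP->|ts]; first by rewrite subrr normr0.
rewrite distrC; apply: H => //=.
by rewrite distrC ger0_norm ?subr_ge0 ?ltW// ltrBlDl.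
Qed.

Lemma within_continuous_pos f :
  {within `[0%R, +oo[, continuous f} -> continuous_pos f.
Proof.
move=> cf t t0 e e0.
have tin : t \in `[0%R, +oo[%classic by rewrite inE/= in_itv/= t0.
have := cf t; rewrite /continuous_at/= => /cvgrPdist_lt/(_ _ e0).
rewrite /nbhs/=/nbhs_subspace/= tin => -[d /= d0 H].
exists d => // s s0 std; rewrite distrC; apply: H => //=.
- by rewrite distrC.
- by rewrite in_itv/= s0.
Qed.

Lemma continuous_pos_right f t : continuous_pos f -> 0 <= t ->
  right_continuous_at f t.
Proof.
move=> cf t0 e e0; have [d d0 H] := cf _ t0 _ e0; exists d => // s ts std.
by apply: H; [exact: le_trans ts|rewrite ger0_norm ?subr_ge0// ltrBlDl].
Qed.

(** Since [g] stays above [g t] to the right of [t], right continuity of [f] suffices. This is all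
    that [X], which has the jumps of [J], offers along the clock [T]. *)
Lemma right_continuous_comp f g t : right_continuous_at g t ->
  (forall s, t <= s -> g t <= g s) ->
  right_continuous_at f (g t) -> right_continuous_at (f \o g) t.
Proof.
move=> cg mg cf e e0; have [d d0 Hf] := cf _ e0; have [d' d'0 Hg] := cg _ d0.
exists d' => // s ts sd'; apply: Hf; first exact: mg.
by rewrite -ltrBlDl; exact: le_lt_trans (ler_norm _) (Hg _ ts sd').
Qed.

Lemma right_continuous_lin (a b : R) f g t :
  right_continuous_at f t -> right_continuous_at g t ->
  right_continuous_at (fun s => a * f s + b * g s) t.
Proof.
move=> cf cg e e0; pose c := `|a| + `|b| + 1.
have c0 : 0 < c by rewrite ltr_wpDl// addr_ge0.
have ec0 : 0 < e / c by rewrite divr_gt0.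
have [d1 d10 H1] := cf _ ec0; have [d2 d20 H2] := cg _ ec0.
exists (Num.min d1 d2); first by rewrite lt_min d10.
move=> s ts; rewrite -ltrBlDl lt_min !ltrBlDl => /andP[s1 s2].
rewrite [X in `|X|](_ : _ = a * (f s - f t) + b * (g s - g t)); last first.
  by rewrite !mulrBr opprD addrACA.
have {}H1 := H1 _ ts s1; have {}H2 := H2 _ ts s2.
apply: le_lt_trans (ler_normD _ _) _; rewrite !normrM.
apply: (@le_lt_trans _ _ ((`|a| + `|b|) * (e / c))).
  by rewrite mulrDl lerD// ler_wpM2l// ltW.
rewrite -[ltRHS](divfK (lt0r_neq0 c0)) [ltRHS]mulrC ltr_pM2r//.
by rewrite /c ltrDl.
Qed.

Lemma right_continuous_at_expR f t :
  right_continuous_at f t -> right_continuous_at (fun s => expR (f s)) t.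
Proof.
move=> cf e e0.
have /cvgrPdist_lt/(_ _ e0) := @continuous_expR R (f t).
move=> -[d /= d0 H]; have [d' d'0 H'] := cf _ d0.
exists d' => // s ts std; rewrite distrC; apply: H => /=.
by rewrite distrC; exact: H'.
Qed.

End Continuity.

(** * Measurability with respect to a complete sub-sigma-algebra *)

Section SubSigmaAlgebra.
Context (d : measure_display) (Omega : measurableType d) (R : realType).
Implicit Types (P : probability Omega R) (K G : set (set Omega)).

(** Moves between a sub-sigma-algebra, given as a set of sets, and the type on which measurable
    functions are closed under the usual operations. *)
Lemma measurable_wrtP K (f : Omega -> R) : sigma_algebra setT K ->
  measurable_wrt K f <->
  measurable_fun setT (f : g_sigma_algebraType K -> R).
Proof.
move=> sK; split=> [mf _ A mA|mf A mA].
  by rewrite setTI /measurable/= sigma_algebra_id//; exact: mf.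
have := mf measurableT _ mA.
by rewrite setTI /measurable/= sigma_algebra_id.
Qed.

Lemma sigma_algebra_measurableE K A : sigma_algebra setT K ->
  K A <-> measurable (A : set (g_sigma_algebraType K)).
Proof. by move=> sK; rewrite /measurable/= sigma_algebra_id. Qed.

Lemma salgT K : sigma_algebra setT K -> K setT.
Proof. by move=> sK; apply/(sigma_algebra_measurableE _ sK); exact: measurableT. Qed.

Lemma salg0 K : sigma_algebra setT K -> K set0.
Proof. by case. Qed.

Lemma salgC K A : sigma_algebra setT K -> K A -> K (~` A).
Proof. by move=> [_ KC _] /KC; rewrite setTD. Qed.

Lemma salgI K A B : sigma_algebra setT K -> K A -> K B -> K (A `&` B).
Proof.
move=> sK /(sigma_algebra_measurableE _ sK) KA /(sigma_algebra_measurableE _ sK) KB.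
by apply/(sigma_algebra_measurableE _ sK); exact: measurableI.
Qed.

Lemma salgU K A B : sigma_algebra setT K -> K A -> K B -> K (A `|` B).
Proof.
move=> sK /(sigma_algebra_measurableE _ sK) KA /(sigma_algebra_measurableE _ sK) KB.
by apply/(sigma_algebra_measurableE _ sK); exact: measurableU.
Qed.

Lemma salgD K A B : sigma_algebra setT K -> K A -> K B -> K (A `\` B).
Proof. by move=> sK KA KB; rewrite setDE; apply: salgI => //; exact: salgC. Qed.

Lemma salg_bigcup K (F : nat -> set Omega) : sigma_algebra setT K ->
  (forall n, K (F n)) -> K (\bigcup_n F n).
Proof. by move=> [_ _ KU] /KU. Qed.

Lemma salg_bigcap K (F : nat -> set Omega) : sigma_algebra setT K ->
  (forall n, K (F n)) -> K (\bigcap_n F n).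
Proof.
move=> sK KF; rewrite -[\bigcap_n _]setCK setC_bigcap; apply: salgC => //.
by apply: salg_bigcup => // n; exact: salgC.
Qed.

Lemma salg_bigcup_rat K (F : rat -> set Omega) : sigma_algebra setT K ->
  (forall q, K (F q)) -> K (\bigcup_q F q).
Proof.
move=> sK KF; apply/(sigma_algebra_measurableE _ sK).
by apply: bigcupT_measurable_rat => q; exact/(sigma_algebra_measurableE _ sK).
Qed.

Lemma salg_bigcap_rat K (F : rat -> set Omega) : sigma_algebra setT K ->
  (forall q, K (F q)) -> K (\bigcap_q F q).
Proof.
move=> sK KF; rewrite -[\bigcap_q _]setCK setC_bigcap; apply: salgC => //.
by apply: salg_bigcup_rat => // q; exact: salgC.
Qed.

Lemma salg_imply K (Q : Prop) A : sigma_algebra setT K ->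
  (Q -> K A) -> K [set w | Q -> A w].
Proof.
move=> sK KA; have [q|nq] := pselect Q.
  suff -> : [set w | Q -> A w] = A by exact: KA.
  by apply/seteqP; split=> w /=; [exact|].
suff -> : [set w | Q -> A w] = setT by exact: salgT.
by apply/seteqP; split=> w // _ /=.
Qed.

Lemma measurable_wrt_cst K (c : R) : sigma_algebra setT K ->
  measurable_wrt K (cst c).
Proof. by move=> sK; apply/measurable_wrtP => //; exact: measurable_cst. Qed.

Lemma measurable_wrtD K (f g : Omega -> R) : sigma_algebra setT K ->
  measurable_wrt K f -> measurable_wrt K g ->
  measurable_wrt K (fun w => f w + g w).
Proof.
move=> sK /(measurable_wrtP _ sK) mf /(measurable_wrtP _ sK) mg.
by apply/(measurable_wrtP _ sK); exact: measurable_funD.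
Qed.

Lemma measurable_wrtM K (f g : Omega -> R) : sigma_algebra setT K ->
  measurable_wrt K f -> measurable_wrt K g ->
  measurable_wrt K (fun w => f w * g w).
Proof.
move=> sK /(measurable_wrtP _ sK) mf /(measurable_wrtP _ sK) mg.
by apply/(measurable_wrtP _ sK); exact: measurable_funM.
Qed.

Lemma measurable_wrtZ K (c : R) (f : Omega -> R) : sigma_algebra setT K ->
  measurable_wrt K f -> measurable_wrt K (fun w => c * f w).
Proof. by move=> sK mf; apply: measurable_wrtM => //; exact: measurable_wrt_cst. Qed.

Lemma measurable_wrtB K (f g : Omega -> R) : sigma_algebra setT K ->
  measurable_wrt K f -> measurable_wrt K g ->
  measurable_wrt K (fun w => f w - g w).
Proof.
move=> sK /(measurable_wrtP _ sK) mf /(measurable_wrtP _ sK) mg.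
by apply/(measurable_wrtP _ sK); exact: measurable_funB.
Qed.

Lemma measurable_wrt_comp K (h : R -> R) (f : Omega -> R) :
  measurable_fun setT h -> measurable_wrt K f ->
  measurable_wrt K (fun w => h (f w)).
Proof.
move=> mh mf A mA; have := mf (h @^-1` A); apply.
by rewrite -[_ @^-1` _]setTI; exact: mh.
Qed.

Lemma measurable_wrt_sum K (I : Type) (r : seq I) (F : I -> Omega -> R) :
  sigma_algebra setT K -> (forall i, measurable_wrt K (F i)) ->
  measurable_wrt K (fun w => \sum_(i <- r) F i w).
Proof.
move=> sK mF; elim: r => [|i r IH].
  rewrite (_ : (fun _ => _) = cst 0); first exact: measurable_wrt_cst.
  by apply/funext => w; rewrite big_nil.
rewrite (_ : (fun _ => _) = (fun w => F i w + \sum_(j <- r) F j w)).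
  exact: measurable_wrtD.
by apply/funext => w; rewrite big_cons.
Qed.

Lemma measurable_wrtS K1 K2 (f : Omega -> R) :
  K1 `<=` K2 -> measurable_wrt K1 f -> measurable_wrt K2 f.
Proof. by move=> K12 mf A mA; apply/K12/mf. Qed.

Lemma measurable_wrt_le K (f : Omega -> R) c : measurable_wrt K f ->
  K [set w | f w <= c].
Proof.
move=> mf; have := mf `]-oo, c]%classic (measurable_itv _); congr K.
Qed.

Lemma measurable_wrt_lt K (f : Omega -> R) c : measurable_wrt K f ->
  K [set w | f w < c].
Proof.
move=> mf; have := mf `]-oo, c[%classic (measurable_itv _); congr K.
Qed.

Lemma measurable_wrt_ge K (f : Omega -> R) c : measurable_wrt K f ->
  K [set w | c <= f w].
Proof.
move=> mf; have := mf `[c, +oo[%classic (measurable_itv _); congr K.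
by apply/seteqP; split=> w /=; rewrite in_itv/= andbT.
Qed.

Lemma measurable_wrt_gt K (f : Omega -> R) c : measurable_wrt K f ->
  K [set w | c < f w].
Proof.
move=> mf; have := mf `]c, +oo[%classic (measurable_itv _); congr K.
by apply/seteqP; split=> w /=; rewrite in_itv/= andbT.
Qed.

Lemma measurable_wrt_of_le K (f : Omega -> R) : sigma_algebra setT K ->
  (forall c, K [set w | f w <= c]) -> measurable_wrt K f.
Proof.
move=> sK Kf; apply/(measurable_wrtP _ sK).
apply: (measurability _ (RGenOInfty.measurableE R)) => _ [_ [c ->] <-].
rewrite setTI; apply/(sigma_algebra_measurableE _ sK).
have := salgC sK (Kf c); congr K.
apply/seteqP; split=> w /=; rewrite in_itv/= andbT ltNge => /negP//.
Qed.

(** Every null set belongs to [K], so a property of almost all paths can be used as if it held for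
    all of them. *)
Definition complete_subalgebra P K :=
  [/\ sigma_algebra setT K, K `<=` measurable & forall N, P.-negligible N -> K N].

Lemma complete_subalgebra_ae P K A B : complete_subalgebra P K ->
  {ae P, forall w, A w <-> B w} -> K A -> K B.
Proof.
move=> [sK _ nK] AB KA.
pose N := ~` [set w | A w <-> B w].
rewrite (_ : B = (A `\` N) `|` (B `&` N)).
  apply: salgU => //; first by apply: salgD => //; exact: nK.
  by apply: nK; apply: negligibleS AB => w [].
apply/seteqP; split=> w.
  move=> Bw; have [Nw|/contrapT Nw] := pselect (N w); first by right.
  by left; split; [exact/Nw.2|move/(_ Nw)].
by case=> [[Aw /contrapT ABw]|[]//]; exact/ABw.1.
Qed.

Lemma measurable_wrt_ae P K (f g : Omega -> R) : complete_subalgebra P K ->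
  {ae P, forall w, f w = g w} -> measurable_wrt K f -> measurable_wrt K g.
Proof.
move=> cK fg mf A mA; apply: (complete_subalgebra_ae cK) (mf _ mA).
by apply: filterS fg => w /= ->.
Qed.

Lemma complete_subalgebra_aeE P K A : complete_subalgebra P K ->
  {ae P, forall w, A w} -> K A.
Proof.
move=> [sK _ nK] Aae; rewrite -[A]setCK; apply: salgC => //.
exact: nK.
Qed.

End SubSigmaAlgebra.

(** * Processes at random times *)

Definition clamp (R : realType) (m x : R) : R := Num.max 0 (Num.min m x).

Lemma clamp_ge0 (R : realType) (m x : R) : 0 <= clamp m x.
Proof. by rewrite le_max lexx. Qed.

Lemma clamp_le (R : realType) (m x : R) : 0 <= m -> clamp m x <= m.
Proof. by move=> m0; rewrite ge_max m0 ge_min lexx. Qed.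

Lemma clamp_id (R : realType) (m x : R) : 0 <= x <= m -> clamp m x = x.
Proof. by case/andP=> x0 xm; rewrite /clamp (min_idPr _)// (max_idPr _). Qed.

Lemma measurable_clamp (R : realType) (m : R) : measurable_fun setT (clamp m).
Proof.
apply: measurable_maxr; first exact: measurable_cst.
by apply: measurable_minr; [exact: measurable_cst|exact: measurable_id].
Qed.

(* The random time is approximated from the right by grid times capped
   at [m], so that only right continuity on [0, m) is used. *)
Lemma measurable_random_time d (T : measurableType d) (R : realType)
    (U : R -> T -> R) (m : R) (xi : T -> R) : 0 <= m ->
  (forall s, 0 <= s -> s <= m -> measurable_fun setT (U s)) ->
  (forall w t, 0 <= t -> t < m -> right_continuous_at (U ^~ w) t) ->
  measurable_fun setT xi -> (forall w, 0 <= xi w <= m) ->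
  measurable_fun setT (fun w => U (xi w) w).
Proof.
move=> m0 mU cU mxi xi0m.
pose a n (k : nat) : R := Num.min m (k.+1%:R / n.+1%:R).
pose k n w := Num.truncn (n.+1%:R * xi w).
have a0m n j : 0 <= a n j <= m.
  by rewrite /a le_min m0 ge_min lexx divr_ge0.
apply: (@measurable_fun_cvg _ _ _ _ (fun n w => U (a n (k n w)) w)).
  move=> n _ B mB; rewrite setTI.
  rewrite (_ : _ @^-1` B = \bigcup_j
     ([set w | j%:R <= n.+1%:R * xi w < j.+1%:R] `&` U (a n j) @^-1` B)).
    apply: bigcupT_measurable => j; apply: measurableI; last first.
      by rewrite -[_ @^-1` B]setTI; apply: mU => //; case/andP: (a0m n j).
    have mn : measurable_fun setT (fun w => n.+1%:R * xi w).
      by apply: measurable_funM => //; exact: measurable_cst.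
    have := mn measurableT `[j%:R, j.+1%:R[%classic (measurable_itv _).
    by rewrite setTI; congr measurable; apply/seteqP; split=> w /=; rewrite in_itv.
  apply/seteqP; split=> w /=.
    move=> H; exists (k n w) => //; split=> //=.
    by apply: truncn_itv; rewrite mulr_ge0//; case/andP: (xi0m w).
  by case=> j _ [/= /truncn_def]; rewrite -/(k n w) => <-.
move=> w _; have /andP[x0 xm] := xi0m w.
move: xm; rewrite le_eqVlt => /orP[/eqP xm|xm].
  rewrite [X in X @ _](_ : _ = cst (U (xi w) w)); first exact: cvg_cst.
  apply/funext => n /=; congr (U _ w); rewrite /a xm; apply/min_idPl.
  by rewrite ler_pdivlMr// mulrC -{1}xm; apply/ltW/truncnS_gt.
apply/cvgrPdist_lt => e e0.
have [dl dl0 H] := cU w _ x0 xm _ e0.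
have dn := near_infty_natSinv_lt (PosNum dl0).
near=> n; rewrite distrC; apply: H.
  rewrite /a le_min (ltW xm)/= ler_pdivlMr// mulrC.
  exact/ltW/truncnS_gt.
rewrite /a gt_min; apply/orP; right.
rewrite ltr_pdivrMr// -natr1 /k.
have /truncn_itv/andP[h _] : 0 <= n.+1%:R * xi w by rewrite mulr_ge0.
rewrite mulrDl; apply: ler_ltD; first by rewrite [leRHS]mulrC.
rewrite -ltr_pdivrMr// mul1r.
by near: n; exact: dn.
Unshelve. all: by end_near. Qed.

Section RandomTimes.
Context (d : measure_display) (Omega : measurableType d) (R : realType).
Implicit Types (P : probability Omega R) (K G : set (set Omega)).

Lemma measurable_wrt_random_time P K (U : R -> Omega -> R) (m : R)
    (xi : Omega -> R) : complete_subalgebra P K -> 0 <= m ->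
  (forall s, 0 <= s -> s <= m -> measurable_wrt K (U s)) ->
  {ae P, forall w, forall t, 0 <= t -> t < m -> right_continuous_at (U ^~ w) t} ->
  measurable_wrt K xi ->
  measurable_wrt K (fun w => U (clamp m (xi w)) w).
Proof.
move=> cK m0 mU cU mxi; have [sK _ _] := cK.
pose O := [set w | forall t, 0 <= t -> t < m -> right_continuous_at (U ^~ w) t].
have KO : K O by exact: (complete_subalgebra_aeE cK).
(* Paths outside the event [O] of [K] are replaced by 0, which makes all paths right continuous
   before [m]. *)
pose V s (w : g_sigma_algebraType K) : R := \1_O w * U s w.
apply: (@measurable_wrt_ae _ _ _ P K (fun w => V (clamp m (xi w)) w)) => //.
  by apply: filterS cU => w Ow; rewrite /V indicE mem_set// mul1r.
apply/measurable_wrtP => //.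
apply: (@measurable_random_time _ _ _ V m (fun w => clamp m (xi w)) m0).
- move=> s s0 sm; apply: measurable_funM.
    by apply: measurable_indic; exact/(sigma_algebra_measurableE _ sK).
  exact/(measurable_wrtP _ sK)/mU.
- move=> w t t0 tm; have [Ow|Ow] := pselect (O w).
    have -> : V ^~ w = U ^~ w by apply/funext => s; rewrite /V indicE mem_set// mul1r.
    exact: Ow.
  have -> : V ^~ w = cst 0 by apply/funext => s; rewrite /V indicE memNset// mul0r.
  by move=> e e0; exists 1 => // s _ _; rewrite subrr normr0.
- apply/(measurable_wrtP _ sK); apply: measurable_wrt_comp mxi.
  exact: measurable_clamp.
- by move=> w; rewrite clamp_ge0 clamp_le.
Qed.

End RandomTimes.

(** * Continuity and adaptedness of the integrated clock *)

Section TimeChange.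
Context (R : realType).
Local Notation leb := (@lebesgue_measure R).

Lemma integrable_continuous_pos (f : R -> R) (t : R) :
  {within `[0%R, +oo[, continuous f} -> leb.-integrable `[0, t] (EFin \o f).
Proof.
move=> cf; apply: continuous_compact_integrable; first exact: segment_compact.
apply: continuous_subspaceW cf => x /=; rewrite !in_itv/= andbT.
by case/andP.
Qed.

Lemma continuous_pos_Rintegral (f : R -> R) :
  {within `[0%R, +oo[, continuous f} ->
  continuous_pos (fun t => \int[leb]_(s in `[0, t]) f s).
Proof.
(* The unit margin keeps [t] away from the right end of the interval. *)
move=> cf t t0 e e0; pose b := t + 1.
have b0 : 0 < b by rewrite ltr_wpDl.
have := parameterized_integral_continuous (ltW b0) (integrable_continuous_pos b cf).
move=> /(_ t); rewrite /continuous_at/= => /cvgrPdist_lt/(_ _ e0).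
have tin : t \in `[0%R, b]%classic.
  by rewrite inE; apply/andP; rewrite !bnd_simp t0 lerDl.
rewrite /nbhs/=/nbhs_subspace/= tin => -[dl /= dl0 H].
exists (Num.min dl 1); first by rewrite lt_min dl0 ltr01.
move=> s s0; rewrite lt_min => /andP[sd s1]; rewrite distrC; apply: H => /=.
  by rewrite distrC.
rewrite in_itv/= s0/= /b -lerBlDl; apply/ltW.
exact: le_lt_trans (ler_norm _) s1.
Qed.

(** Tonelli's theorem on the product of [K] with the Borel sets; the nonnegativity of [v] serves
    there. *)
Lemma measurable_wrt_time_change d (Omega : measurableType d)
    (P : probability Omega R) (K : set (set Omega)) (v : R -> Omega -> R)
    (t : R) : complete_subalgebra P K -> 0 <= t ->
  (forall s, 0 <= s -> s <= t -> measurable_wrt K (v s)) ->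
  {ae P, forall w, {within `[0%R, +oo[, continuous (v ^~ w)}} ->
  {ae P, forall w, forall s, 0 <= s -> 0 <= v s w} ->
  measurable_wrt K (time_change v t).
Proof.
move=> cK t0 mv cv v0; have [sK _ _] := cK.
pose O := [set w | continuous_pos (v ^~ w) /\ forall s, 0 <= s -> 0 <= v s w].
have Oae : {ae P, forall w, O w}.
  by apply: filterS2 cv v0 => w cw vw; split => //; exact: within_continuous_pos.
have KO : K O by exact: (complete_subalgebra_aeE cK).
pose V s (w : g_sigma_algebraType K) : R := \1_O w * v s w.
have mV s : 0 <= s -> s <= t -> measurable_fun setT (V s).
  move=> s0 st; apply: measurable_funM.
    by apply: measurable_indic; exact/(sigma_algebra_measurableE _ sK).
  exact/(measurable_wrtP _ sK)/mv.
have cV w : continuous_pos (V ^~ w).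
  have [Ow|Ow] := pselect (O w).
    have -> : V ^~ w = v ^~ w by apply/funext => s; rewrite /V indicE mem_set// mul1r.
    by case: Ow.
  have -> : V ^~ w = cst 0 by apply/funext => s; rewrite /V indicE memNset// mul0r.
  by move=> s _ e e0; exists 1 => // u _ _; rewrite subrr normr0.
have V0 s w : 0 <= s -> 0 <= V s w.
  move=> s0; have [Ow|Ow] := pselect (O w).
    by rewrite /V indicE mem_set// mul1r; apply: Ow.2.
  by rewrite /V indicE memNset// mul0r.
pose f (z : g_sigma_algebraType K * measurableTypeR R) : \bar R :=
  (V (clamp t z.2) z.1 * \1_`[0, t]%classic z.2)%:E.
have mf : measurable_fun setT f.
  apply/measurable_EFinP; apply: measurable_funM.
    (* Joint measurability is the case in which the second coordinate of the product is the random
       time. *)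
    apply: (@measurable_random_time _ _ _ (fun s z => V s z.1) t (fun z => clamp t z.2) t0).
    - by move=> s s0 st; apply: measurableT_comp (mV _ s0 st) _; exact: measurable_fst.
    - by move=> z s s0 _; exact: continuous_pos_right (cV z.1) s0.
    - by apply: measurableT_comp (measurable_clamp t) _; exact: measurable_snd.
    - by move=> z; rewrite clamp_ge0 clamp_le.
  apply: measurableT_comp; last exact: measurable_snd.
  by apply: measurable_indic; exact: measurable_itv.
have f0 z : (0 <= f z)%E.
  by rewrite lee_fin mulr_ge0// V0// clamp_ge0.
have mF := measurable_fun_fubini_tonelli_F (m2 := leb) f mf f0.
apply: (@measurable_wrt_ae _ _ _ P K (fun w => fine (fubini_F leb f w))) => //; last first.
  apply/(measurable_wrtP _ sK); apply: measurableT_comp mF.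
  exact: fine_measurable.
apply: filterS Oae => w Ow; rewrite /time_change /Rintegral; congr fine.
rewrite [RHS]integral_mkcond /fubini_F; apply: eq_integral => s _.
rewrite /f/= epatch_indic /= EFinM; have [st|st] := pselect (`[0, t]%classic s).
  rewrite /V [\1_O _]indicE mem_set// mul1r clamp_id//.
by rewrite indicE memNset// !mule0.
Qed.

End TimeChange.

(** * Independence of an event from a sigma-algebra *)

Section Independence.
Context (d : measure_display) (Omega : measurableType d) (R : realType).
Implicit Types (P : probability Omega R) (K G : set (set Omega)).

Lemma measure_ae_iff P A B : measurable A -> measurable B ->
  {ae P, forall w, A w <-> B w} -> P A = P B.
Proof.
move=> mA mB AB.
have H C D : measurable C -> measurable D ->
    {ae P, forall w, C w <-> D w} -> P C = P (C `&` D).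
  move=> mC mD CD; rewrite (measureDI P mC mD) [X in (X + _)%E](_ : _ = 0%E) ?add0e//.
  apply: measure_negligible; first exact: measurableD.
  by apply: negligibleS CD => w [Cw Dw] /= -[/(_ Cw)].
rewrite (H _ _ mA mB AB) setIC -(H _ _ mB mA)//.
by apply: filterS AB => w ABw; exact: iff_sym.
Qed.

Lemma generatedI G A B : <<s G >> A -> <<s G >> B -> <<s G >> (A `&` B).
Proof. by move=> hA hB; exact: (salgI (smallest_sigma_algebra _ _) hA hB). Qed.

Lemma generatedT G : <<s G >> setT.
Proof. exact: (salgT (smallest_sigma_algebra _ _)). Qed.

(** [D] is a single event of the future and [K] a whole past; the product rule with this one [D] is
    what makes an event of [K] null once it is null on [D]. *)
Definition independent_event P K D :=
  forall A, K A -> P (A `&` D) = (P A * P D)%E.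

(** Dynkin's argument: the events satisfying the product rule with [D] form a lambda-system. *)
Lemma independent_event_generated P G D : measurable D -> setI_closed G ->
  G `<=` measurable -> independent_event P G D -> independent_event P <<s G >> D.
Proof.
move=> mD GI mG iG.
pose H := [set A | measurable A /\ P (A `&` D) = (P A * P D)%E].
suff : <<s G >> `<=` H by move=> GH A /GH[].
apply: lambda_system_subset => //; last by move=> A GA; split; [exact: mG|exact: iG].
split => //.
- by split; [exact: measurableT|rewrite setTI probability_setT mul1e].
- move=> A B BA [mA PA] [mB PB]; split; first exact: measurableD.
  rewrite (_ : (A `\` B) `&` D = (A `&` D) `\` B); last by rewrite !setDE setIAC.
  have mAD := measurableI _ _ mA mD.
  have finP C : measurable C -> (P C < +oo)%E.
    by move=> mC; rewrite ltey_eq fin_num_measure.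
  have mD' C : measurable C -> P (C `\` B) = (P C - P (C `&` B))%E.
    by move=> mC; apply: measureD => //; exact: finP.
  rewrite !mD'//.
  rewrite setIAC (setIidr BA) PA PB muleBl// ?fin_num_measure//.
  by rewrite fin_num_adde_defr// fin_num_measure.
- move=> A ndA HA; split; first by apply: bigcupT_measurable => n; have [] := HA n.
  have mA n : measurable (A n) by have [] := HA n.
  have c1 : (P (A n) * P D)%E @[n --> \oo] --> (P (\bigcup_n A n) * P D)%E.
    apply: cvgeZr; first exact: fin_num_measure.
    exact: nondecreasing_cvg_mu (bigcupT_measurable _ mA) ndA.
  have c2 : P (A n `&` D) @[n --> \oo] --> P (\bigcup_n A n `&` D).
    rewrite setI_bigcupl; apply: nondecreasing_cvg_mu.
    + by move=> n; exact: measurableI.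
    + by apply: bigcupT_measurable => n; exact: measurableI.
    + by move=> m n mn; apply/subsetPset; apply: setSI; apply/subsetPset/ndA.
  have E : (fun n => P (A n `&` D)) = (fun n => (P (A n) * P D)%E).
    by apply/funext => n; have [] := HA n.
  by rewrite E in c2; exact: (cvg_unique _ c2 c1).
Qed.

(* The three sigma-algebras need not be independent of each other: only their
   join is independent of [D]. *)
Lemma independent_event_join3 P G1 G2 G3 D : measurable D ->
  (forall N, P.-negligible N -> measurable N) ->
  G1 `<=` measurable -> G2 `<=` measurable -> G3 `<=` measurable ->
  (forall A1 A2 A3, <<s G1 >> A1 -> <<s G2 >> A2 -> <<s G3 >> A3 ->
    P (A1 `&` A2 `&` A3 `&` D) = (P (A1 `&` A2 `&` A3) * P D)%E) ->
  independent_event P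
    <<s G1 `|` G2 `|` G3 `|` [set N | P.-negligible N] >> D.
Proof.
move=> mD null_measurable mG1 mG2 mG3 H.
have sm G : G `<=` measurable -> <<s G >> `<=` @measurable _ Omega.
  by move=> mG; apply: smallest_sub => //; exact: sigma_algebra_measurable.
(* This pi-system is taken up to null sets, so that the null sets themselves belong to it, with an
   empty intersection. *)
pose C := [set A | measurable A /\ exists A1 A2 A3,
  [/\ <<s G1 >> A1, <<s G2 >> A2, <<s G3 >> A3
    & {ae P, forall w, A w <-> (A1 `&` A2 `&` A3) w}]].
have CI : setI_closed C.
  move=> A B [mA [A1 [A2 [A3 [hA1 hA2 hA3 hA]]]]] [mB [B1 [B2 [B3 [hB1 hB2 hB3 hB]]]]].
  split; first exact: measurableI.
  exists (A1 `&` B1), (A2 `&` B2), (A3 `&` B3); split; try exact: generatedI.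
  apply: filterS2 hA hB => w [h1 h2] [h3 h4]; split.
    by case=> /h1[[? ?] ?] /h3[[? ?] ?].
  by move=> [[[? ?] [? ?]] [? ?]]; split; [exact: h2|exact: h4].
have Cm : C `<=` measurable by move=> A [].
have iC : independent_event P C D.
  move=> A [mA [A1 [A2 [A3 [hA1 hA2 hA3 hA]]]]].
  have mA123 : measurable (A1 `&` A2 `&` A3).
    apply: measurableI; first apply: measurableI.
    - exact: sm mG1 _ hA1.
    - exact: sm mG2 _ hA2.
    - exact: sm mG3 _ hA3.
  rewrite (measure_ae_iff mA mA123 hA) -H//; apply: measure_ae_iff.
  - exact: measurableI.
  - exact: measurableI.
  - by apply: filterS hA => w [h1 h2]; split=> -[? ?]; split; auto.
have gT := @generatedT.
move=> A hA; apply: (independent_event_generated mD CI Cm iC).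
move: A hA; apply: smallest_sub; first exact: smallest_sigma_algebra.
move=> A hA; apply: sub_sigma_algebra; move: hA => -[[[hA|hA]|hA]|hA]; split.
- exact: mG1.
- by exists A, setT, setT; split=> //; [exact: sub_sigma_algebra|apply: aeW => w; rewrite !setIT].
- exact: mG2.
- by exists setT, A, setT; split=> //; [exact: sub_sigma_algebra|apply: aeW => w; rewrite setTI setIT].
- exact: mG3.
- by exists setT, setT, A; split=> //; [exact: sub_sigma_algebra|apply: aeW => w; rewrite !setTI].
- exact: null_measurable.
- exists set0, setT, setT; split=> //; first exact: salg0.
  by rewrite !setIT; apply: negligibleS hA => w /= h; apply: contrapT => nA; apply: h.
Qed.

End Independence.

(** * Brownian motion stays below a decreasing line *)

Section BrownianSteps.
Context (d : measure_display) (Omega : measurableType d) (R : realType).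
Variables (P : probability Omega R) (F : R -> set (set Omega)).
Variables (B : R -> Omega -> R).
Hypotheses (hF : filtration F) (hB : brownian_motion P F B).

Let sF s : 0 <= s -> sigma_algebra setT (F s).
Proof. by case: hF => h _ _; exact: h. Qed.

Let Fm s : 0 <= s -> F s `<=` measurable.
Proof. by case: hF => _ h _; exact: h. Qed.

Let mono s t : 0 <= s -> s <= t -> F s `<=` F t.
Proof. by case: hF => _ _; exact. Qed.

Let Badapted s t : 0 <= s -> s <= t -> measurable_wrt (F t) (B s).
Proof.
by move=> s0 st; apply: measurable_wrtS (mono s0 st) _; case: hB => h _ _ _ _; exact: h.
Qed.

Let incr_measurable s t u : 0 <= s -> 0 <= t -> s <= u -> t <= u ->
  measurable_wrt (F u) (fun w => B t w - B s w).
Proof.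
move=> s0 t0 su tu; apply: measurable_wrtB; last exact: Badapted.
  by apply: sF; exact: le_trans su.
exact: Badapted.
Qed.

Definition increments (s h : R) (n : nat) : set (set Omega) :=
  \bigcup_(i in [set i | (i < n)%N])
     events_of (fun w => B (s + i.+1%:R * h) w - B (s + i%:R * h) w).

Lemma increments_measurable s h n : 0 <= s -> 0 <= h ->
  <<s increments s h n >> `<=` F (s + n%:R * h).
Proof.
move=> s0 h0; apply: smallest_sub; first by apply: sF; rewrite addr_ge0// mulr_ge0.
move=> _ [i /= ni [A mA <-]]; apply: incr_measurable => //.
- by rewrite addr_ge0// mulr_ge0.
- by rewrite addr_ge0// mulr_ge0.
- by rewrite lerD2l ler_wpM2r// ler_nat ltnW.
- by rewrite lerD2l ler_wpM2r// ler_nat.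
Qed.

(** Induction on [n]: the last increment is independent of [F u], which contains both [F s] and the
    earlier increments. Intersections of an event of the earlier increments with one of the last
    form the generating pi-system. *)
Lemma increments_independent s h n D : 0 <= s -> 0 < h ->
  <<s increments s h n >> D -> independent_event P (F s) D.
Proof.
move=> s0 h0; elim: n D => [|n IH] D hD.
  (* Without increments the generated sigma-algebra is trivial. *)
  have : [set setT; set0] D.
    move: D hD; apply: smallest_sub.
      split; first by right.
      - by move=> A [->|->]; [right; rewrite setDv|left; rewrite setD0].
      - move=> A hA; have [[n An]|nA] := pselect (exists n, A n = setT).
          by left; apply/seteqP; split=> // w _; exists n => //; rewrite An.
        right; apply/seteqP; split=> // w [n _]; have [An|->//] := hA n.
        by move=> _; apply: nA; exists n.
    by move=> A [].
  case=> -> A FA; first by rewrite setIT probability_setT mule1.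
  by rewrite setI0 measure0 mule0.
pose u := s + n%:R * h.
have u0 : 0 <= u by rewrite addr_ge0// mulr_ge0// ltW.
have su : s <= u by rewrite lerDl mulr_ge0// ltW.
have uu : u < s + n.+1%:R * h by rewrite ltrD2l ltr_pM2r// ltr_nat.
pose inc := (fun w => B (s + n.+1%:R * h) w - B u w).
have incI : independent P (F u) (events_of inc).
  by case: hB => _ _ _ H _; exact: H.
have incE (A I : set Omega) : F u A -> events_of inc I -> P (A `&` I) = (P A * P I)%E.
  by move=> FA hI; apply: incI; exact: sub_sigma_algebra.
pose C := [set D | exists D1 I,
  [/\ <<s increments s h n >> D1, events_of inc I & D = D1 `&` I]].
have mC : C `<=` measurable.
  move=> _ [D1 [I [hD1 [A mA <-] ->]]]; apply: measurableI.
    exact/(Fm u0)/(increments_measurable s0 (ltW h0)).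
  apply: (Fm (ltW (le_lt_trans u0 uu))).
  by apply: incr_measurable => //; rewrite ltW// (le_lt_trans u0).
have CI : setI_closed C.
  move=> _ _ [D1 [_ [hD1 [A mA <-] ->]]] [D2 [_ [hD2 [A' mA' <-] ->]]].
  exists (D1 `&` D2), (inc @^-1` (A `&` A')); split.
  - exact: generatedI.
  - by exists (A `&` A') => //; exact: measurableI.
  - by rewrite preimage_setI setIACA.
move=> A FA.
have mA : measurable A by exact: Fm FA.
suff iA : independent_event P <<s C >> A.
  have hD' : <<s C >> D.
    move: D hD; apply: smallest_sub; first exact: smallest_sigma_algebra.
    move=> I [i /= + hI]; rewrite ltnS leq_eqVlt => /orP[/eqP ni|ni].
      apply: sub_sigma_algebra; exists setT, I; split => //.
      - exact: generatedT.
      - by rewrite /inc /u -ni.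
      - by rewrite setTI.
    apply: sub_sigma_algebra; exists I, setT; split => //.
    - by apply: sub_sigma_algebra; exists i.
    - by exists setT.
    - by rewrite setIT.
  by rewrite setIC (iA _ hD') muleC.
apply: independent_event_generated => // _ [D1 [I [hD1 hI ->]]].
have FD1 : F u D1 by exact: (increments_measurable s0 (ltW h0)).
have FA' : F u A by exact: mono FA.
rewrite setIAC incE//; last by apply: salgI => //; exact: sF.
by rewrite (incE D1 I)// (setIC D1 A) (IH D1)// (muleC (P A)) muleAC.
Qed.

Lemma increment_measurable_wrt s h n i : (i <= n)%N ->
  measurable_wrt <<s increments s h n >> (fun w => B (s + i%:R * h) w - B s w).
Proof.
move=> ni.
have sI : sigma_algebra setT <<s increments s h n >> by exact: smallest_sigma_algebra.
elim: i ni => [|i IH] ni.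
  rewrite (_ : (fun _ => _) = cst 0); first exact: measurable_wrt_cst.
  by apply/funext => w; rewrite mul0r addr0 subrr.
rewrite (_ : (fun _ => _) = (fun w => (B (s + i.+1%:R * h) w - B (s + i%:R * h) w) +
   (B (s + i%:R * h) w - B s w))).
  have mi := IH (ltnW ni).
  apply: measurable_wrtD => //.
  by move=> A mA; apply: sub_sigma_algebra; exists i => //; exists A.
by apply/funext => w; rewrite addrA subrK.
Qed.

End BrownianSteps.

(** * Uniform continuity, dyadic oscillation and a Gaussian lower bound *)

Section ContinuityUniform.
Context (R : realType).

(** Heine's theorem on [[0, M]] by compactness; the second point may lie outside the interval. *)
Lemma continuous_pos_uniform (f : R -> R) (M e : R) : continuous_pos f -> 0 < e ->
  exists2 dl, 0 < dl & forall x y, 0 <= x <= M -> 0 <= y -> `|y - x| <= dl ->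
    `|f y - f x| <= e.
Proof.
move=> cf e0.
have /compact_near_coveringP/near_covering_withinP := @segment_compact R 0 M.
move=> /(_ R (0^'+)%R (fun dl x => forall y, 0 <= y -> `|y - x| <= dl -> `|f y - f x| <= e)).
case.
  move=> x /=; rewrite in_itv/= => /andP[x0 xM].
  have e20 : 0 < e / 2 by rewrite divr_gt0.
  have [dl dl0 H] := cf _ x0 _ e20.
  near=> x' dl' => /=; rewrite in_itv/= => /andP[x'0 x'M] y y0 yx'.
  have x'x : `|x' - x| < dl / 2.
    rewrite distrC; near: x'; apply: (@cvgr_dist_lt _ _ _ (nbhs x)) => //.
    by rewrite divr_gt0.
  have yx : `|y - x| < dl.
    rewrite (splitr dl) -(subrK x' y) -addrA; apply: le_lt_trans (ler_normD _ _) _.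
    apply: ler_ltD => //; apply: le_trans yx' _.
    by near: dl'; apply: nbhs_right_le; rewrite divr_gt0.
  rewrite -(subrK (f x) (f y)) -addrA (le_trans (ler_normD _ _))// (splitr e).
  apply/ltW/ltrD; first exact: H.
  rewrite distrC; apply: H => //; apply: lt_trans x'x _.
move=> dl /= dl0 H; exists (dl / 2); first by rewrite divr_gt0.
move=> x y x0M y0 yx; apply: (H (dl / 2)) => //=; rewrite ?divr_gt0//.
rewrite sub0r normrN gtr0_norm ?divr_gt0//.
by rewrite ltr_pdivrMr// ltr_pMr// ltr1n.
Unshelve. all: by end_near. Qed.

(** By continuity a larger deviation at [r] would show at the grid point just to the left of [r] on
    a fine dyadic grid. The oscillation on an interval thus depends on countably many increments. *)
Lemma dyadic_bound (f : R -> R) (s h dl : R) : continuous_pos f -> 0 <= s -> 0 < h ->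
  (forall n i, (i <= 2 ^ n)%N -> `|f (s + i%:R * (h / (2 ^ n)%:R)) - f s| <= dl) ->
  forall r, s <= r <= s + h -> `|f r - f s| <= dl.
Proof.
move=> cf s0 h0 H r /andP[sr rsh]; rewrite leNgt; apply/negP => dlr.
have r0 : 0 <= r by exact: le_trans sr.
have e0 : 0 < `|f r - f s| - dl by rewrite subr_gt0.
have [d0 d00 Hd] := cf _ r0 _ e0.
have [n hn] : exists n, h / (2 ^ n)%:R < d0.
  have hd0 : 0 <= h / d0 by rewrite divr_ge0// ltW.
  exists (Num.truncn (h / d0)).+1; rewrite ltr_pdivrMr ?ltr0n ?expn_gt0//.
  rewrite mulrC -ltr_pdivrMr//; apply: lt_trans (truncnS_gt _) _.
  by rewrite ltr_nat; exact: ltn_expl.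
pose k := h / (2 ^ n)%:R; have k0 : 0 < k by rewrite divr_gt0// ltr0n expn_gt0.
pose i := Num.truncn ((r - s) / k).
have /truncn_itv/andP[i1 i2] : 0 <= (r - s) / k.
  by rewrite divr_ge0 ?subr_ge0// ltW.
have i1' : s + i%:R * k <= r by rewrite -lerBrDl -ler_pdivlMr.
have i2' : r < s + i%:R * k + k.
  by rewrite -addrA -ltrBlDl -{2}[k]mul1r -mulrDl natr1 -ltr_pdivrMr.
have iN : (i <= 2 ^ n)%N.
  rewrite -(@ler_nat R); apply: le_trans i1 _; rewrite ler_pdivrMr// /k.
  by rewrite mulrC divfK ?pnatr_eq0 -?lt0n ?expn_gt0// lerBlDl.
have := H n i iN; apply/negP; rewrite -ltNge -/k.
have : `|f (s + i%:R * k) - f r| < `|f r - f s| - dl.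
  apply: Hd; first by rewrite addr_ge0// mulr_ge0// ltW.
  rewrite distrC ger0_norm ?subr_ge0//; apply: lt_trans hn.
  by rewrite ltrBlDl.
rewrite ltrBrDr => /(fun h => lt_le_trans h (ler_distD (f (s + i%:R * k)) _ _)).
by rewrite (distrC (f r)) ltrD2l.
Qed.

(** The interval has length [s] and lies within two standard deviations of 0, where the density is
    at least its peak times [expR (-2)]; the scale [s] cancels. *)
Lemma normal_prob_step (s x : R) : 0 < s -> (x = s \/ x = - s *+ 2) ->
  ((expR (-2) / Num.sqrt (pi *+ 2))%:E <= normal_prob 0 s `[x, (x + s)%R])%E.
Proof.
move=> s0 hx; have sne : s != 0 by rewrite gt_eqF.
have hsq y : x <= y <= x + s -> y ^+ 2 <= (s *+ 2) ^+ 2.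
  move=> /andP[xy yx]; rewrite -[leLHS]real_normK ?num_real//.
  rewrite ler_sqr ?nnegrE//; last by rewrite mulrn_wge0// ltW.
  rewrite ler_norml; case: hx => hx; rewrite hx in xy yx.
    by apply/andP; split; [apply: le_trans xy; lra|apply: le_trans yx _; lra].
  by apply/andP; split; [apply: le_trans xy; lra|apply: le_trans yx _; lra].
have pE : normal_peak s = s^-1 * (Num.sqrt (pi *+ 2))^-1.
  rewrite /normal_peak -mulrnAr sqrtrM ?sqr_ge0// sqrtr_sqr gtr0_norm//.
  by rewrite invfM.
apply: (@le_trans _ _ (\int[lebesgue_measure]_(y in `[x, (x + s)%R])
   (normal_peak s * expR (-2))%:E)%E).
  rewrite integral_cst//= lebesgue_measure_itv/= lte_fin ltrDl s0 -EFinD.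
  rewrite addrAC subrr add0r -EFinM lee_fin pE.
  by rewrite -(mulrC s) !mulrA divff// mul1r mulrC.
apply: ge0_le_integral => //=.
- by move=> y _; rewrite lee_fin mulr_ge0// ?normal_peak_ge0// expR_ge0.
- by apply/measurable_EFinP; apply: measurable_funTS; exact: measurable_normal_pdf.
- move=> y; rewrite in_itv/= => xy; rewrite lee_fin normal_pdfE//.
  rewrite ler_wpM2l ?normal_peak_ge0// ler_expR subr0.
  rewrite mulNr lerN2 ler_pdivrMr; last by rewrite mulrn_wgt0// exprn_gt0.
  apply: le_trans (hsq _ xy) _.
  rewrite -[_ *+ 2]mulr_natr exprMn -[s ^+ 2 *+ 2]mulr_natr; nra.
Qed.

End ContinuityUniform.

(** * The barrier event and its positive probability *)

Section BrownianBarrier.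
Context (d : measure_display) (Omega : measurableType d) (R : realType).
Variables (P : probability Omega R) (F : R -> set (set Omega)).
Variables (B : R -> Omega -> R) (e c dl : R).
Hypotheses (hF : filtration F) (hB : brownian_motion P F B).
Hypotheses (e1 : e = 1 \/ e = -1) (c0 : 0 <= c) (dl0 : 0 < dl).

Let down s h : set Omega := [set w | e * (B (s + h) w - B s w) <= - (c * h)].

(** One dyadic grid only, hence an event of finitely many increments of equal length; the
    intersection over [n] controls the whole step of a continuous path. *)
Let osc s h n : set Omega := \bigcap_i [set w | (i <= 2 ^ n)%N ->
  `|B (s + i%:R * (h / (2 ^ n)%:R)) w - B s w| <= dl / 2].

Let step s h := down s h `&` \bigcap_n osc s h n.

Let pow2_gt0 n : (0 : R) < (2 ^ n)%:R. Proof. by rewrite ltr0n expn_gt0. Qed.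

Let osc_sigma K (s h : R) n : sigma_algebra setT K ->
  (forall i, (i <= 2 ^ n)%N ->
     measurable_wrt K (fun w => B (s + i%:R * (h / (2 ^ n)%:R)) w - B s w)) ->
  K (osc s h n).
Proof.
move=> sK H; apply: salg_bigcap => // i; apply: salg_imply => // iN.
apply: (@measurable_wrt_le _ _ _ K
  (fun w => `|B (s + i%:R * (h / (2 ^ n)%:R)) w - B s w|)).
apply: (measurable_wrt_comp (h := Num.Def.normr)) (H _ iN).
exact: normr_measurable.
Qed.

Let down_sigma K (s h : R) : sigma_algebra setT K ->
  measurable_wrt K (fun w => B (s + h) w - B s w) -> K (down s h).
Proof. by move=> sK H; apply: measurable_wrt_le; exact: measurable_wrtZ. Qed.

Let grid_in (s h : R) n i : 0 <= h -> (i <= 2 ^ n)%N ->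
  s <= s + i%:R * (h / (2 ^ n)%:R) <= s + h.
Proof.
move=> h0 iN; rewrite lerDl lerD2l mulr_ge0 ?divr_ge0//=.
by rewrite mulrCA ler_piMr// ler_pdivrMr// mul1r ler_nat.
Qed.

Let step_sigma K (s h : R) : sigma_algebra setT K -> 0 <= h ->
  (forall u, s <= u -> u <= s + h -> measurable_wrt K (B u)) -> K (step s h).
Proof.
move=> sK h0 H; have Bs : measurable_wrt K (B s) by apply: H; rewrite ?lerDl.
apply: salgI => //.
  by apply: down_sigma => //; apply: measurable_wrtB => //; apply: H; rewrite ?lerDl.
apply: salg_bigcap => // n; apply: osc_sigma => // i /(grid_in s h0)/andP[? ?].
by apply: measurable_wrtB => //; exact: H.
Qed.

Let F_sigma (s : R) : 0 <= s -> sigma_algebra setT (F s).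
Proof. by case: hF => h _ _; exact: h. Qed.

Let B_adapted (s t : R) : 0 <= s -> s <= t -> measurable_wrt (F t) (B s).
Proof.
move=> s0 st; case: hF => _ _ mono; apply: measurable_wrtS (mono _ _ s0 st) _.
by case: hB => h _ _ _ _; exact: h.
Qed.

Let step_F (s h : R) : 0 <= s -> 0 <= h -> F (s + h) (step s h).
Proof.
move=> s0 h0; apply: step_sigma => //; first exact/F_sigma/addr_ge0.
by move=> u su ush; apply: B_adapted => //; exact: le_trans su.
Qed.

Let F_measurable (s : R) : 0 <= s -> F s `<=` measurable.
Proof. by case: hF => _ h _; exact: h. Qed.

Let osc_decr s h n : osc s h n.+1 `<=` osc s h n.
Proof.
move=> w H i _ /= iN; have := H (2 * i)%N I; rewrite /= expnS leq_mul2l iN orbT.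
move=> /(_ isT); rewrite natrM [(2 * 2 ^ n)%:R]natrM invfM.
rewrite [_ * (h * _)](_ : _ = i%:R * (h / (2 ^ n)%:R))//.
by have /lt0r_neq0 := pow2_gt0 n; move: (_%:R) => y y0; field.
Qed.

(** Each grid gives an event of finitely many increments, to which [increments_independent] applies.
    Finer grids give smaller events, and both sides of the product rule pass to the limit by
    continuity from above. *)
Let step_independent (s h : R) : 0 <= s -> 0 < h -> independent_event P (F s) (step s h).
Proof.
move=> s0 h0 A FA; pose stepn n := down s h `&` osc s h n.
have mA : measurable A by exact: F_measurable FA.
have stepE : step s h = \bigcap_n stepn n.
  apply/seteqP; split=> [w [dw ow] n _|w H]; first by split; [|exact: ow].
  by split=> [|n _]; [case: (H 0%N I)|case: (H n I)].
have hn n : 0 < h / (2 ^ n)%:R by rewrite divr_gt0.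
have stepn_incr n : <<s increments B s (h / (2 ^ n)%:R) (2 ^ n) >> (stepn n).
  have sI := smallest_sigma_algebra setT (increments B s (h / (2 ^ n)%:R) (2 ^ n)).
  have mI := @increment_measurable_wrt _ _ _ B s (h / (2 ^ n)%:R) (2 ^ n).
  apply: (salgI sI); last by apply: osc_sigma => // i; exact: mI.
  apply: down_sigma => //; have := mI _ (leqnn _).
  by rewrite [(2 ^ n)%:R * (h / _)]mulrC divfK// gt_eqF.
have mstep n : measurable (stepn n).
  apply: (F_measurable (s := s + (2 ^ n)%:R * (h / (2 ^ n)%:R))).
    by rewrite addr_ge0// mulr_ge0// ltW.
  exact: (increments_measurable hF hB s0 (ltW (hn n))).
have decr : {homo stepn : n m / (n <= m)%N >-> (m <= n)%O}.
  apply/nonincreasing_seqP => n; apply/subsetPset; apply: setIS; exact: osc_decr.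
have finP (C : set Omega) : measurable C -> (P C < +oo)%E.
  by move=> mC; rewrite ltey_eq fin_num_measure.
have c1 : (P A * P (stepn n))%E @[n --> \oo] --> (P A * P (step s h))%E.
  apply: cvgeZl; first exact: fin_num_measure.
  rewrite stepE; apply: nonincreasing_cvg_mu => //; first exact: finP.
  by apply: bigcap_measurableType.
have c2 : P (A `&` stepn n) @[n --> \oo] --> P (A `&` step s h).
  have -> : A `&` step s h = \bigcap_n (A `&` stepn n).
    rewrite stepE; apply/seteqP; split=> [w [Aw sw] n _|w H].
      by split=> //; exact: sw.
    by split=> [|n _]; [case: (H 0%N I)|case: (H n I)].
  apply: nonincreasing_cvg_mu.
  - by apply: finP; exact: measurableI.
  - by move=> n; exact: measurableI.
  - by apply: bigcap_measurableType => n _; exact: measurableI.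
  - by move=> m n mn; apply/subsetPset; apply: setIS; apply/subsetPset/decr.
have E : (fun n => P (A `&` stepn n)) = (fun n => (P A * P (stepn n))%E).
  apply/funext => n.
  exact: (increments_independent hF hB s0 (hn n) (stepn_incr n)).
by rewrite E in c2; exact: (cvg_unique _ c2 c1).
Qed.

Let p0 : R := expR (-2) / Num.sqrt (pi *+ 2).

Let p0_gt0 : 0 < p0.
Proof. by rewrite divr_gt0 ?expR_gt0// sqrtr_gt0 mulrn_wgt0// pi_gt0. Qed.

(* [p0] bounds from below the probability that a centred normal variable of
   standard deviation [s] lies in [s, 2 s]. *)
Let down_prob (s h : R) : 0 <= s -> 0 < h -> c * Num.sqrt h <= 1 ->
  (p0%:E <= P (down s h))%E.
Proof.
move=> s0 h0 ch; pose r := Num.sqrt h; have r0 : 0 < r by rewrite sqrtr_gt0.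
have ssh : s < s + h by rewrite ltrDl.
have hE : c * h <= r.
  have -> : c * h = c * r * r by rewrite -mulrA -expr2 sqr_sqrtr// ltW.
  by rewrite ger_pMl.
pose A := [set x : R | e * x <= - (c * h)].
have mA : measurable A.
  have := measurable_wrt_le (K := measurable) (f := fun x : R => e * x) (- (c * h)).
  apply=> C mC; rewrite -[_ @^-1` C]setTI.
  have mE : measurable_fun setT (fun x : R => e * x) by exact: measurable_funM.
  exact: mE measurableT _ mC.
have -> : P (down s h) = normal_prob 0 r A.
  by case: hB => _ _ _ _ H; rewrite (H _ _ s0 ssh A mA) addrAC subrr add0r.
have sub x : x = r \/ x = - r *+ 2 -> `[x, x + r] `<=` A ->
    (p0%:E <= normal_prob 0 r A)%E.
  move=> hx xA; apply: le_trans (normal_prob_step r0 hx) _.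
  apply: ge0_subset_integral => //.
  - by apply/measurable_EFinP; apply: measurable_funTS; exact: measurable_normal_pdf.
  - by move=> y _; rewrite lee_fin normal_pdf_ge0.
case: e1 => eE; [apply: (sub (- r *+ 2)); [by right|]|apply: (sub r); [by left|]];
  move=> y /=; rewrite in_itv/= /A /= eE => /andP[? ?]; lra.
Qed.

Let steps := fix steps (b h : R) (j : nat) : set Omega :=
  if j is j'.+1 then steps b h j' `&` step (b + j'%:R * h) h else setT.

Let stepsS b h j : steps b h j.+1 = steps b h j `&` step (b + j%:R * h) h.
Proof. by []. Qed.

Let steps_in b h j k : (k < j)%N -> steps b h j `<=` step (b + k%:R * h) h.
Proof.
elim: j => // j IH; rewrite ltnS leq_eqVlt stepsS => /orP[/eqP->|kj] w [Hw sw] //.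
exact: IH.
Qed.

(** Proved together: the next step is independent of [F (b + j%:R * h)], so the earlier steps have
    to be known to lie there. *)
Let steps_F (b h : R) j : 0 <= b -> 0 < h ->
  [/\ F (b + j%:R * h) (steps b h j), <<s all_events B >> (steps b h j)
    & independent_event P (F b) (steps b h j)].
Proof.
move=> b0 h0; elim: j => [|j [IH1 IH2 IH3]].
  rewrite mul0r addr0; split; first exact: (salgT (F_sigma b0)).
    exact: (@generatedT _ Omega).
  by move=> A FA; rewrite setIT probability_setT mule1.
have bj0 : 0 <= b + j%:R * h by rewrite addr_ge0// mulr_ge0// ltW.
have bj1 : b + j.+1%:R * h = b + j%:R * h + h by rewrite -natr1 mulrDl mul1r addrA.
have bjj : b + j%:R * h <= b + j.+1%:R * h by rewrite bj1 lerDl ltW.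
case: (hF) => _ _ mono.
rewrite stepsS; split.
- apply: salgI; first by apply: F_sigma; exact: le_trans bjj.
    exact: (mono _ _ bj0 bjj).
  by rewrite bj1; apply: step_F => //; exact: ltW.
- apply: generatedI => //; apply: step_sigma; [exact: smallest_sigma_algebra|exact: ltW|].
  move=> u bu _ A mA; apply: sub_sigma_algebra; exists u => /=.
    exact: le_trans bu.
  by exists A.
- move=> A FA; have FA' : F (b + j%:R * h) A.
    by apply: (mono b) => //; rewrite lerDl mulr_ge0// ltW.
  rewrite setIA step_independent//; last by apply: salgI => //; exact: F_sigma.
  by rewrite IH3// step_independent// muleA.
Qed.

Let steps_gt0 (b h : R) j : 0 <= b -> 0 < h ->
  (forall k, (k < j)%N -> (0 < P (step (b + k%:R * h) h))%E) ->
  (0 < P (steps b h j))%E.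
Proof.
move=> b0 h0; elim: j => [|j IH] H; first by rewrite probability_setT lte01.
have bj0 : 0 <= b + j%:R * h by rewrite addr_ge0// mulr_ge0// ltW.
rewrite stepsS step_independent//; last by have [] := steps_F j b0 h0.
apply: mule_gt0; last exact: H.
by apply: IH => k kj; apply: H; rewrite ltnS ltnW.
Qed.

(** After [k] full steps the path is below the line without slack. Inside the current step it rises
    by at most [dl / 2] and the line falls by at most [c * h <= dl / 2]. *)
Let steps_barrier (b h : R) n w : 0 <= b -> 0 < h -> c * h <= dl / 2 ->
  continuous_pos (B ^~ w) -> steps b h n w ->
  forall r, 0 <= r < n%:R * h -> e * (B (b + r) w - B b w) <= - (c * r) + dl.
Proof.
move=> b0 h0 ch cw sw r /andP[r0 rn].
have steps_le k : (k <= n)%N -> e * (B (b + k%:R * h) w - B b w) <= - (c * (k%:R * h)).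
  elim: k => [|k IH] kn; first by rewrite mul0r addr0 subrr !mulr0 oppr0.
  have [+ _] := steps_in kn sw; rewrite /down /= => H1.
  have H2 := IH (ltnW kn).
  have bE : b + k.+1%:R * h = b + k%:R * h + h by rewrite -natr1 mulrDl mul1r addrA.
  rewrite bE; move: H1 H2; rewrite -[k.+1%:R]natr1.
  by move: (B _ w) (B _ w) (B _ w) => x y z; nra.
pose k := Num.truncn (r / h).
have /truncn_itv/andP[k1 k2] : 0 <= r / h by rewrite divr_ge0// ltW.
rewrite -/k in k1 k2.
have kn : (k < n)%N.
  rewrite -(@ltr_nat R); apply: le_lt_trans k1 _.
  by rewrite ltr_pdivrMr.
have {}k1 : k%:R * h <= r by rewrite -ler_pdivlMr.
have {}k2 : r < k%:R * h + h.
  by rewrite -{2}[h]mul1r -mulrDl natr1 -ltr_pdivrMr.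
have bk0 : 0 <= b + k%:R * h by rewrite addr_ge0// mulr_ge0// ltW.
have H1 := steps_le _ (ltnW kn).
have [_ ow] := steps_in kn sw.
have H2 : `|B (b + r) w - B (b + k%:R * h) w| <= dl / 2.
  apply: (@dyadic_bound _ (B ^~ w) (b + k%:R * h) h) => //.
    by move=> m i im; exact: (ow m I i I im).
  by apply/andP; split; [rewrite lerD2l|rewrite -addrA lerD2l ltW].
have ckr : c * r <= c * (k%:R * h) + dl / 2.
  apply: le_trans (_ : c * (k%:R * h + h) <= _); first by rewrite ler_wpM2l// ltW.
  by rewrite mulrDr lerD2l.
move: H2; rewrite ler_norml => /andP[H2 H3].
move: H1 H2 H3 ckr; move: (c * r) (c * _) (B _ w) (B _ w) (B _ w) => x y p q z.
by case: e1 => ->; lra.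
Qed.

(* On each of the [n] steps of length [h = L / n] the increment is at most
   [- c h] with probability at least [p0], which does not depend on [h], while
   by uniform continuity some step oscillates by more than [dl / 2] with
   probability less than [p0] once [n] is large.  Hence each step is good with
   positive probability, and the steps are independent. *)
Lemma brownian_barrier (b L : R) : 0 <= b -> 0 < L ->
  exists D, [/\ <<s all_events B >> D, independent_event P (F b) D, (0 < P D)%E
    & {ae P, forall w, D w ->
        forall r, 0 <= r <= L -> e * (B (b + r) w - B b w) <= - (c * r) + dl}].
Proof.
move=> b0 L0.
have Bcont : {ae P, forall w, continuous_pos (B ^~ w)}.
  by case: hB => _ _ cB _ _; apply: filterS cB => w; exact: within_continuous_pos.
pose h n := L / n.+1%:R; have h0 n : 0 < h n by rewrite divr_gt0.
(* One step more than the [n.+1] that cover [[0, L]], because [steps_barrier] excludes the right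
   end. *)
pose O n := \bigcap_k [set w | (k < n.+2)%N -> (\bigcap_m osc (b + k%:R * h n) (h n) m) w].
have mosc s n m : 0 <= s -> measurable (osc s (h n) m).
  move=> s0; apply: (F_measurable (s := s + h n)); first by rewrite addr_ge0// ltW.
  apply: osc_sigma; first by apply: F_sigma; rewrite addr_ge0// ltW.
  move=> i /(grid_in s (ltW (h0 n)))/andP[? ?]; apply: measurable_wrtB.
  - by apply: F_sigma; rewrite addr_ge0// ltW.
  - by apply: B_adapted => //; exact: le_trans s0 _.
  - by apply: B_adapted => //; rewrite lerDl ltW.
have bk0 n k : 0 <= b + k%:R * h n by rewrite addr_ge0// mulr_ge0// ltW.
have mO n : measurable (O n).
  apply: bigcap_measurableType => k _; apply: (salg_imply (sigma_algebra_measurable _)) => _.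
  by apply: bigcap_measurableType => m _; exact: mosc.
pose E N := \bigcap_n [set w | (N <= n)%N -> O n w].
have mE N : measurable (E N).
  by apply: bigcap_measurableType => k _; apply: (salg_imply (sigma_algebra_measurable _)) => _.
have E1 : P (\bigcup_N E N) = 1%E.
  rewrite -(probability_setT P); apply: measure_ae_iff; [exact: bigcupT_measurable|by []|].
  apply: filterS Bcont => w cw; split=> // _.
  have dl20 : 0 < dl / 2 by rewrite divr_gt0.
  have [eta eta0 H] := continuous_pos_uniform (b + L + L) cw dl20.
  have [N HN] : exists N : nat, forall n, (N <= n)%N -> h n <= eta.
    exists (Num.truncn (L / eta)) => n Nn.
    rewrite /h ler_pdivrMr// mulrC -ler_pdivrMr//.
    by apply/ltW/(lt_le_trans (truncnS_gt _)); rewrite ler_nat.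
  exists N => // n _ /= Nn k _ /= kn m _ i _ /= im.
  have /andP[g1 g2] := grid_in (b + k%:R * h n) (ltW (h0 n)) im.
  apply: H; [|exact: le_trans (bk0 n k) g1|].
    rewrite bk0/= -addrA lerD2l.
    have -> : L + L = (n.+1%:R + n.+1%:R) * h n.
      by rewrite /h mulrDl mulrC divfK.
    rewrite ler_wpM2r ?(ltW (h0 n))// -natrD ler_nat.
    exact: (leq_trans (n := n.+1) kn (leq_addr _ _)).
  by rewrite ger0_norm ?subr_ge0// lerBlDl; apply: le_trans g2 _; rewrite lerD2l HN.
have [N1 HN1] : exists N1 : nat, forall n, (N1 <= n)%N ->
    c * h n <= dl / 2 /\ c * Num.sqrt (h n) <= 1.
  (* The two terms serve [steps_barrier] and [down_prob]; [c + 1] replaces [c], which may be 0. *)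
  pose eta := Num.min (dl / 2 / (c + 1)) ((c + 1) ^- 2).
  have c1 : 0 < c + 1 by rewrite ltr_wpDl.
  have eta0 : 0 < eta by rewrite lt_min !divr_gt0//= invr_gt0 exprn_gt0.
  exists (Num.truncn (L / eta)) => n Nn.
  have : h n <= eta.
    rewrite /h ler_pdivrMr// mulrC -ler_pdivrMr//.
    by apply/ltW/(lt_le_trans (truncnS_gt _)); rewrite ler_nat.
  rewrite le_min => /andP[H1 H2]; split.
    apply: le_trans (_ : (c + 1) * h n <= _); last by rewrite mulrC -ler_pdivlMr.
    by rewrite ler_wpM2r ?lerDl// ltW.
  apply: le_trans (_ : (c + 1) * Num.sqrt (h n) <= _).
    by rewrite ler_wpM2r ?lerDl.
  have cE : Num.sqrt ((c + 1) ^- 2) = (c + 1)^-1.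
    by rewrite -exprVn sqrtr_sqr ger0_norm// invr_ge0 ltW.
  by rewrite -ler_pdivlMl// mulr1 -cE ler_wsqrtr.
have [N [N1N HN]] : exists N, (N1 <= N)%N /\ ((1 - p0)%:E < P (E N))%E.
  apply: contrapT => H.
  have cE : P (E n) @[n --> \oo] --> 1%E.
    rewrite -E1; apply: nondecreasing_cvg_mu => //; first exact: bigcupT_measurable.
    move=> m n mn; apply/subsetPset => w Ew k _ /= nk.
    by apply: (Ew k I); exact: leq_trans nk.
  have : (limn (fun n => P (E n)) <= (1 - p0)%:E)%E.
    apply: lime_le; first by apply/cvg_ex; exists 1%E.
    exists N1 => // n /= N1n; rewrite leNgt; apply/negP => Hn.
    by apply: H; exists n.
  by rewrite (cvg_lim _ cE)// lee_fin leNgt => /negP; apply; rewrite ltrBlDl ltrDr.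
have [ch csq] := HN1 _ N1N.
have step0 k : (k < N.+2)%N -> (0 < P (step (b + k%:R * h N) (h N)))%E.
  move=> kN; set s := b + _.
  have s0 : 0 <= s by exact: bk0.
  have msf : measurable (step s (h N)).
    by apply: (F_measurable (s := s + h N)); [rewrite addr_ge0// ltW|apply: step_F => //; exact: ltW].
  (* [down] is covered by the good step and the complement of [E N]; a null step would bound [p0] by
     the probability of that complement, which is smaller. *)
  rewrite lt_neqAle measure_ge0 andbT; apply/eqP => P0.
  have mC : measurable (~` E N) by exact: measurableC.
  have : (P (down s (h N)) <= P (step s (h N) `|` ~` E N))%E.
    apply: le_measure; rewrite ?inE.
    - apply: (F_measurable (s := s + h N)); first by rewrite addr_ge0// ltW.
      apply: down_sigma; first by apply: F_sigma; rewrite addr_ge0// ltW.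
      apply: measurable_wrtB; first by apply: F_sigma; rewrite addr_ge0// ltW.
        by apply: B_adapted => //; rewrite addr_ge0// ltW.
      by apply: B_adapted => //; rewrite lerDl ltW.
    - exact: measurableU.
    - move=> w dw; have [Ew|] := pselect (E N w); last by right.
      by left; split=> //; exact: (Ew N I (leqnn _) k I kN).
  have U2 : (P (step s (h N) `|` ~` E N) <= P (step s (h N)) + P (~` E N))%E.
    exact: measureU2.
  move=> /(le_trans (down_prob s0 (h0 N) csq))/le_trans/(_ U2).
  rewrite -P0 add0e probability_setC// leNgt => /negP; apply.
  have fE : P (E N) \is a fin_num by exact: fin_num_measure.
  rewrite -(fineK fE) in HN *; rewrite -EFinB lte_fin; rewrite lte_fin in HN.
  by rewrite ltrBlDl -ltrBlDr.
exists (steps b (h N) N.+2); have [_ S1 S2] := steps_F N.+2 b0 (h0 N).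
split=> //; first exact: steps_gt0.
apply: filterS Bcont => w cw sw r /andP[r0 rL].
apply: (steps_barrier (h := h N) (n := N.+2)) => //; rewrite r0/=.
apply: (le_lt_trans rL); rewrite /h mulrCA ltr_pMr// ltr_pdivlMr// mul1r.
by rewrite ltr_nat.
Qed.

End BrownianBarrier.

(** * Reduction to one-step strategies *)

Section Filtered.
Context (d : measure_display) (Omega : measurableType d) (R : realType).
Variables (P : probability Omega R) (H : R -> set (set Omega)).
Hypothesis Hc : forall t, 0 <= t -> complete_subalgebra P (H t).
Hypothesis Hmono : forall s t, 0 <= s -> s <= t -> H s `<=` H t.
Implicit Types (tau sigma : Omega -> R) (S : R -> Omega -> R).

Lemma stopping_timeP tau :
  stopping_time H (EFin \o tau) <->
  (forall w, 0 <= tau w) /\ (forall t, 0 <= t -> H t [set w | tau w <= t]).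
Proof. by split. Qed.

Lemma stopped_sigma_algebraP (tau : Omega -> \bar R) :
  (forall t, 0 <= t -> H t [set w | (tau w <= t%:E)%E]) ->
  sigma_algebra setT (stopped_sigma_algebra H tau).
Proof.
move=> Ht; split.
- by split=> // t t0; rewrite set0I; have [sH _ _] := Hc t0; exact: salg0.
- move=> A [mA hA]; split; first exact: measurableD.
  move=> t t0; have [sH _ _] := Hc t0.
  rewrite setTD (_ : ~` A `&` _ = [set w | (tau w <= t%:E)%E] `\`
     (A `&` [set w | (tau w <= t%:E)%E])); first by apply: salgD => //; auto.
  by apply/seteqP; split=> w /=; rewrite /setC /setD /setI /=; tauto.
- move=> A hA; split; first by apply: bigcupT_measurable => n; have [] := hA n.
  move=> t t0; have [sH _ _] := Hc t0; rewrite setI_bigcupl.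
  by apply: salg_bigcup => // n; have [_] := hA n; exact.
Qed.

Lemma stopped_sigma_algebraS tau sigma :
  (forall t, 0 <= t -> H t [set w | sigma w <= t]) ->
  (forall w, tau w <= sigma w) ->
  stopped_sigma_algebra H (EFin \o tau) `<=` stopped_sigma_algebra H (EFin \o sigma).
Proof.
move=> Hs ts A [mA hA]; split=> // t t0; have [sH _ _] := Hc t0.
rewrite (_ : A `&` _ = (A `&` [set w | tau w <= t]) `&` [set w | sigma w <= t]).
  by apply: salgI => //; [exact: hA|exact: Hs].
apply/seteqP; split=> w /=; rewrite lee_fin.
  by move=> [Aw sw]; split=> //; split=> //; exact: le_trans sw.
by move=> [[]].
Qed.

(** On the event that [tau] is at most [t], [S] at [tau] is [S] at the minimum of [tau] and [t], a
    random time measurable with respect to [H t]. *)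
Lemma measurable_wrt_stopped S tau : adapted H S ->
  {ae P, forall w, forall t, 0 <= t -> right_continuous_at (S ^~ w) t} ->
  stopping_time H (EFin \o tau) ->
  measurable_wrt (stopped_sigma_algebra H (EFin \o tau)) (fun w => S (tau w) w).
Proof.
move=> aS cS /stopping_timeP[tau0 Ht] A mA.
have main t : 0 <= t ->
    H t ([set w | A (S (tau w) w)] `&` [set w | tau w <= t]).
  move=> t0; have [sH _ _] := Hc t0.
  pose xi w := Num.min (tau w) t.
  have mxi : measurable_wrt (H t) xi.
    apply: measurable_wrt_of_le => // c.
    have [tc|ct] := leP t c.
      rewrite (_ : [set _ | _] = setT); first exact: salgT.
      by apply/seteqP; split=> // w _ /=; rewrite /xi ge_min tc orbT.
    have [c0|c0] := leP 0 c.
      rewrite (_ : [set _ | _] = [set w | tau w <= c]).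
        by apply: Hmono (Ht _ c0) => //; exact: ltW.
      by apply/seteqP; split=> w /=; rewrite /xi ge_min [t <= c]leNgt ct orbF.
    rewrite (_ : [set _ | _] = set0); first exact: salg0.
    apply/seteqP; split=> // w /=; rewrite /xi ge_min => /orP[]; rewrite leNgt => /negP; apply.
      exact: lt_le_trans c0 _.
    exact: lt_le_trans c0 _.
  have mS := measurable_wrt_random_time (U := S) (Hc t0) t0 _ _ mxi.
  have {}mS : measurable_wrt (H t) (fun w => S (clamp t (xi w)) w).
    apply: mS.
      by move=> s s0 st; apply: measurable_wrtS (Hmono s0 st) _; exact: aS.
    by apply: filterS cS => w cw s s0 _; exact: cw.
  rewrite (_ : _ `&` _ = [set w | A (S (clamp t (xi w)) w)] `&` [set w | tau w <= t]).
    by apply: salgI => //; [exact: mS|exact: Ht].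
  apply/seteqP; split=> w /= [Aw tw]; split=> //; move: Aw;
    by rewrite /xi (min_idPl tw) clamp_id// tau0.
split; last by move=> t t0; exact: main.
rewrite (_ : _ @^-1` A = \bigcup_n ([set w | A (S (tau w) w)] `&` [set w | tau w <= n%:R])).
  apply: bigcupT_measurable => n; have [_ Hm _] := Hc (ler0n R n).
  exact/Hm/main.
apply/seteqP; split=> w; last by case=> n _ [].
move=> Aw; exists (Num.truncn (tau w)).+1 => //; split=> //=.
exact/ltW/truncnS_gt.
Qed.

(** One unit bought ([e = 1]) or sold short ([e = -1]) on [A] at [tau] and liquidated at [sigma]. *)
Definition one_step_free S := forall tau sigma A (e K : R),
  stopping_time H (EFin \o tau) -> stopping_time H (EFin \o sigma) ->
  (forall w, tau w <= sigma w) -> (forall w, sigma w <= K) ->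
  stopped_sigma_algebra H (EFin \o tau) A -> (e = 1 \/ e = -1) ->
  {ae P, forall w, A w -> 0 <= e * (S (sigma w) w - S (tau w) w)} ->
  {ae P, forall w, A w -> S (sigma w) w - S (tau w) w = 0}.

Let partial_gain (h : strategy Omega R) S k w :=
  \sum_(1 <= j < k) st_g h j w * (S (st_tau h j.+1 w) w - S (st_tau h j w) w).

(* If the partial gain [G_k] is negative with positive probability, then on the
   event [G_k < 0], intersected with the sign of [g_k], the [k]-th step alone is
   an arbitrage; otherwise [G_k = 0] by induction and the [k]-th step carries
   the whole gain. *)
Lemma no_arbitrage_of_one_step S : adapted H S ->
  {ae P, forall w, forall t, 0 <= t -> right_continuous_at (S ^~ w) t} ->
  one_step_free S -> no_arbitrage P S (simple_strategies H).
Proof.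
move=> aS cS one f [mf f0]; split; last first.
  (* The zero strategy attains the gain 0. *)
  move=> f00; pose h := @Strategy _ Omega R 2 0 (fun _ _ => 0) (fun _ _ => 0).
  have Hst : stopping_time H (EFin \o (fun _ : Omega => 0 : R)).
    apply/stopping_timeP; split=> // t t0; have [sH _ _] := Hc t0.
    rewrite (_ : [set _ | _] = setT); first exact: salgT.
    by apply/seteqP; split.
  exists h.
    split=> //; first by exists 0.
    move=> j _; apply: measurable_wrt_cst; apply: stopped_sigma_algebraP.
    by case: Hst.
  by apply: filterS f00 => w ->; rewrite /terminal_gain big1// => j _; rewrite mul0r.
move=> [h [n2 tau_mono [K tauK] tau_st g_meas] hf].
pose n := st_n h.
have tau_le w i j : (1 <= i)%N -> (i <= j)%N -> (j <= n)%N -> st_tau h i w <= st_tau h j w.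
  move=> i1 ij jn; elim: j ij jn => [|j IH]; first by rewrite leqn0 => /eqP->.
  rewrite leq_eqVlt => /orP[/eqP->//|ij jn].
  apply: le_trans (IH ij (ltnW jn)) _; apply: (tau_mono w).2.
  by rewrite (leq_trans i1 ij) jn.
have Hst j : (1 <= j <= n)%N -> forall t, 0 <= t -> H t [set w | st_tau h j w <= t].
  by move=> /tau_st/stopping_timeP[].
have sS j : (1 <= j <= n)%N -> sigma_algebra setT (stopped_sigma_algebra H (EFin \o st_tau h j)).
  by move=> jn; apply: stopped_sigma_algebraP => t t0; exact: Hst.
have gm k : (1 <= k <= n)%N ->
    measurable_wrt (stopped_sigma_algebra H (EFin \o st_tau h k)) (partial_gain h S k).
  case/andP=> k1 kn; have kk : (1 <= k <= n)%N by rewrite k1.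
  (* The guard makes the summand measurable for every index, as [measurable_wrt_sum] requires. *)
  rewrite (_ : partial_gain h S k = fun w => \sum_(j <- index_iota 1 k)
      (if (1 <= j < k)%N then st_g h j w * (S (st_tau h j.+1 w) w - S (st_tau h j w) w) else 0)).
    apply: measurable_wrt_sum => [|j]; first exact: sS.
    case: (boolP (0 < j < k)%N) => [/andP[j1 jk]|_]; last exact: (measurable_wrt_cst 0 (sS k kk)).
    have up i : (1 <= i <= k)%N -> stopped_sigma_algebra H (EFin \o st_tau h i) `<=`
        stopped_sigma_algebra H (EFin \o st_tau h k).
      case/andP=> i1 ik; apply: stopped_sigma_algebraS; first exact: Hst.
      by move=> w; exact: tau_le.
    have jn : (j < n)%N by exact: leq_trans kn.
    have mSi i : (1 <= i <= k)%N -> measurable_wrt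
        (stopped_sigma_algebra H (EFin \o st_tau h k)) (fun w => S (st_tau h i w) w).
      move=> ik; apply: measurable_wrtS (up _ ik) _; apply: measurable_wrt_stopped => //.
      by apply: tau_st; case/andP: ik => -> /= /leq_trans; exact.
    apply: measurable_wrtM; first exact: sS.
      by apply: measurable_wrtS (up j _) (g_meas _ _); rewrite j1// ltnW.
    by apply: measurable_wrtB; [exact: sS|apply: mSi|apply: mSi; rewrite j1 ltnW].
  apply/funext => w; rewrite /partial_gain big_seq_cond [RHS]big_seq_cond.
  by apply: eq_bigr => j; rewrite mem_index_iota andbT => ->.
have main k : (1 <= k <= n)%N -> {ae P, forall w, 0 <= partial_gain h S k w} ->
    {ae P, forall w, partial_gain h S k w = 0}.
  elim: k => [//|k IH /andP[_ kn]].
  have [->|k0] := posnP k.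
    by move=> _; apply: aeW => w; rewrite /partial_gain big_geq.
  have kk : (1 <= k <= n)%N by rewrite k0 ltnW.
  have gS w : partial_gain h S k.+1 w = partial_gain h S k w +
      st_g h k w * (S (st_tau h k.+1 w) w - S (st_tau h k w) w).
    by rewrite /partial_gain big_nat_recr.
  move=> G0.
  have step A (e : R) : (e = 1 \/ e = -1) ->
      stopped_sigma_algebra H (EFin \o st_tau h k) A ->
      {ae P, forall w, A w -> 0 <= e * (S (st_tau h k.+1 w) w - S (st_tau h k w) w)} ->
      {ae P, forall w, A w -> S (st_tau h k.+1 w) w - S (st_tau h k w) w = 0}.
    move=> e1 hA; apply: (one (st_tau h k) _ _ _ K) => //.
    - exact: tau_st.
    - exact: tau_st.
    - by move=> w; exact: tau_le.
    - by move=> w; apply: le_trans (tauK w); exact: tau_le.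
  have sk := sS k kk.
  have gk : measurable_wrt (stopped_sigma_algebra H (EFin \o st_tau h k)) (st_g h k).
    by apply: g_meas; rewrite k0.
  have Aneg := measurable_wrt_lt 0 (gm k kk).
  have gpos := measurable_wrt_gt 0 gk; have gneg := measurable_wrt_lt 0 gk.
  have Gk0 : {ae P, forall w, 0 <= partial_gain h S k w}.
    have s1 := step _ 1 (or_introl erefl) (salgI sk Aneg gpos).
    have s2 := step _ (-1) (or_intror erefl) (salgI sk Aneg gneg).
    have {}s1 := s1 _; have {}s2 := s2 _.
    have h1 : {ae P, forall w, ([set w | partial_gain h S k w < 0] `&` [set w | 0 < st_g h k w]) w ->
        0 <= 1 * (S (st_tau h k.+1 w) w - S (st_tau h k w) w)}.
      apply: filterS G0 => w; rewrite gS => G [/= G1 g1]; rewrite mul1r.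
      rewrite -(pmulr_rge0 _ g1); apply: le_trans G _.
      by rewrite gerDr ltW.
    have h2 : {ae P, forall w, ([set w | partial_gain h S k w < 0] `&` [set w | st_g h k w < 0]) w ->
        0 <= -1 * (S (st_tau h k.+1 w) w - S (st_tau h k w) w)}.
      apply: filterS G0 => w; rewrite gS => G [/= G1 g1]; rewrite mulN1r oppr_ge0.
      rewrite -(nmulr_rge0 _ g1); apply: le_trans G _.
      by rewrite gerDr ltW.
    apply: filterS3 G0 (s1 h1) (s2 h2) => w; rewrite gS => G a1 a2.
    rewrite leNgt; apply/negP => G1; move: G; apply/negP; rewrite -ltNge.
    have [g0|g0|g0] := ltgtP (st_g h k w) 0.
    - by rewrite a2 ?mulr0 ?addr0.
    - by rewrite a1 ?mulr0 ?addr0.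
    - by rewrite g0 mul0r addr0.
  have Gk := IH kk Gk0.
  have h1 : {ae P, forall w, [set w | 0 < st_g h k w] w ->
      0 <= 1 * (S (st_tau h k.+1 w) w - S (st_tau h k w) w)}.
    apply: filterS2 G0 Gk => w; rewrite gS => /[swap] ->; rewrite add0r mul1r => G g1.
    by rewrite -(pmulr_rge0 _ g1).
  have h2 : {ae P, forall w, [set w | st_g h k w < 0] w ->
      0 <= -1 * (S (st_tau h k.+1 w) w - S (st_tau h k w) w)}.
    apply: filterS2 G0 Gk => w; rewrite gS => /[swap] ->; rewrite add0r mulN1r => G g1.
    by rewrite oppr_ge0 -(nmulr_rge0 _ g1).
  apply: filterS3 Gk (step _ 1 (or_introl erefl) gpos h1) (step _ (-1) (or_intror erefl) gneg h2).
  move=> w; rewrite gS => -> a1 a2; rewrite add0r.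
  have [g0|g0|->] := ltgtP (st_g h k w) 0; last by rewrite mul0r.
    by rewrite a2// mulr0.
  by rewrite a1// mulr0.
have G0 : {ae P, forall w, 0 <= partial_gain h S n w}.
  by apply: filterS2 hf f0 => w <-.
have nn : (1 <= n <= n)%N by rewrite leqnn andbT ltnW.
by apply: filterS2 (main n nn G0) hf => w G <-.
Qed.

End Filtered.

(** * The time-changed filtration *)

Section TimeChangedFiltration.
Context (d : measure_display) (Omega : measurableType d) (R : realType).
Variables (P : probability Omega R) (H : R -> set (set Omega)).
Variable (T : R -> Omega -> R).
Hypothesis Hc : forall t, 0 <= t -> complete_subalgebra P (H t).
Hypothesis Hmono : forall s t, 0 <= s -> s <= t -> H s `<=` H t.

Definition clock (w : Omega) := [/\ continuous_pos (T ^~ w), T 0 w = 0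
  & forall s t, 0 <= s -> s < t -> T s w < T t w].

Hypothesis aT : adapted H T.
Hypothesis Tclock : {ae P, forall w, clock w}.
Implicit Types (tau sigma : Omega -> R).

Local Notation C := (inverse_time_change T).
Local Notation G := (fun t => stopped_sigma_algebra H (C t)).

Lemma clock_le w s t : clock w -> 0 <= s -> s <= t -> T s w <= T t w.
Proof.
by move=> [_ _ inc] s0; rewrite le_eqVlt => /orP[/eqP->//|st]; exact/ltW/inc.
Qed.

Lemma clock_ge0 w t : clock w -> 0 <= t -> 0 <= T t w.
Proof. by move=> cw t0; case: (cw) => _ <- _; exact: clock_le. Qed.

(** Continuity gives the direct implication. Conversely, if [T] has only just reached [t] at [s],
    strict increase makes it exceed [t] immediately afterwards. *)
Lemma inverse_time_change_le w (t s : R) : clock w -> 0 <= t -> 0 <= s ->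
  (C t w <= s%:E)%E <-> t <= T s w.
Proof.
move=> cw t0 s0; have [cT T0 inc] := cw; split=> [Cs|tT].
  rewrite leNgt; apply/negP => Tst.
  have gap : 0 < t - T s w by rewrite subr_gt0.
  have [dl dl0 Hd] := cT _ s0 _ gap.
  have : ((s + dl)%:E <= C t w)%E.
    apply: le_ereal_inf_tmp => _ [u /= [u0 tTu] <-]; rewrite lee_fin leNgt; apply/negP => us.
    have [us'|su] := leP u s.
      by have := clock_le cw (ltW u0) us'; lra.
    have := Hd u (ltW u0); rewrite ger0_norm ?subr_ge0 ?(ltW su)// ltrBlDl => /(_ us).
    by rewrite ltr_norml => /andP[_]; rewrite ltrD2r; lra.
  by move=> /le_trans/(_ Cs); rewrite lee_fin; lra.
apply/lee_addgt0Pr => e e0; apply: ereal_inf_lbound; exists (s + e) => //=.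
by split; [rewrite ltr_wpDl|apply: le_lt_trans tT _; apply: inc; rewrite ?ltrDl].
Qed.

Lemma inverse_time_change_stopping t s : 0 <= t -> 0 <= s ->
  H s [set w | (C t w <= s%:E)%E].
Proof.
move=> t0 s0; apply: (complete_subalgebra_ae (Hc s0) (A := [set w | t <= T s w])).
  by apply: filterS Tclock => w cw; apply: iff_sym; exact: inverse_time_change_le.
by apply: measurable_wrt_ge; exact: aT.
Qed.

Lemma time_changed_complete t : 0 <= t -> complete_subalgebra P (G t).
Proof.
move=> t0; split.
- by apply: (stopped_sigma_algebraP Hc) => s s0; exact: inverse_time_change_stopping.
- by move=> A [].
- move=> N nN; have [_ Hm H0] := Hc (lexx 0); split; first exact/Hm/H0.
  move=> s s0; have [_ _ Hs] := Hc s0; apply: Hs.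
  by apply: negligibleS nN => w [].
Qed.

Lemma time_changed_mono s t : 0 <= s -> s <= t -> G s `<=` G t.
Proof.
move=> s0 st A [mA hA]; split=> // u u0; have [sH _ _] := Hc u0.
rewrite (_ : A `&` _ = (A `&` [set w | (C s w <= u%:E)%E]) `&` [set w | (C t w <= u%:E)%E]).
  apply: salgI => //; first exact: hA.
  by apply: inverse_time_change_stopping => //; exact: le_trans st.
apply/seteqP; split=> w /=; last by move=> [[]].
move=> [Aw Ct]; split=> //; split=> //; apply: le_trans Ct.
by apply: ereal_inf_le_tmp => _ [v /= [v0 tv] <-]; exists v => //=; split=> //; exact: le_lt_trans tv.
Qed.

(** Strategies and stopping times are constrained at every [w], hence the default value 0 off the
    almost sure event [clock]. *)
Definition changed_time tau (w : Omega) : R :=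
  if `[< clock w >] then T (tau w) w else 0.

Lemma changed_timeE tau w : clock w -> changed_time tau w = T (tau w) w.
Proof. by move=> cw; rewrite /changed_time asboolT. Qed.

Lemma changed_time_ge0 tau w : 0 <= tau w -> 0 <= changed_time tau w.
Proof. by move=> t0; rewrite /changed_time; case: asboolP => // cw; exact: clock_ge0. Qed.

Lemma changed_time_le tau sigma w : 0 <= tau w -> tau w <= sigma w ->
  changed_time tau w <= changed_time sigma w.
Proof. by move=> t0 ts; rewrite /changed_time; case: asboolP => // cw; exact: clock_le. Qed.

Lemma measurable_changed_time tau : stopping_time H (EFin \o tau) ->
  measurable_wrt measurable (changed_time tau).
Proof.
move=> ht.
have measurable_complete : complete_subalgebra P (@measurable _ Omega).
  split=> //; first exact: sigma_algebra_measurable.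
  by move=> N nN; have [_ Hm H0] := Hc (lexx 0); exact/Hm/H0.
apply: (@measurable_wrt_ae _ _ _ P measurable (fun w => T (tau w) w)) => //.
  by apply: filterS Tclock => w cw; rewrite changed_timeE.
apply: (measurable_wrtS (K1 := stopped_sigma_algebra H (EFin \o tau))); first by move=> A [].
apply: (measurable_wrt_stopped Hc Hmono aT _ ht).
by apply: filterS Tclock => w [cT _ _] t t0; exact: continuous_pos_right.
Qed.

(** It has to be seen at time [s], on the event [t <= T s], whether [T tau <= t]. Strict increase
    then forces [tau <= s], so the position is already open and [A] is known. With [A = setT],
    [T tau] becomes a stopping time of the time-changed filtration. *)
Lemma changed_time_le_sigma tau A t : stopping_time H (EFin \o tau) ->
  stopped_sigma_algebra H (EFin \o tau) A -> 0 <= t ->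
  G t (A `&` [set w | changed_time tau w <= t]).
Proof.
move=> ht [mA hA] t0; have [tau0 htau] := (stopping_timeP H tau).1 ht; split.
  by apply: measurableI => //; apply: measurable_wrt_le; exact: measurable_changed_time.
move=> s s0; have [sH _ _] := Hc s0.
(* The event that [T tau] exceeds [t]: the clock has reached [t] at some rational instant before
   [tau]. *)
pose bad := \bigcup_q (if 0 <= (ratr q : R) <= s then
   [set w | t <= T (ratr q) w] `&` [set w | ratr q < tau w] else set0).
apply: (complete_subalgebra_ae (Hc s0)
  (A := ((A `&` [set w | tau w <= s]) `&` [set w | t <= T s w]) `\` bad)); last first.
  apply: salgD => //.
    by apply: salgI => //; [exact: hA|apply: measurable_wrt_ge; exact: aT].
  apply: salg_bigcup_rat => // q; case: ifPn => [/andP[q0 qs]|_]; last exact: salg0.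
  apply: (Hmono q0 qs); have [sHq _ _] := Hc q0; apply: salgI => //.
    by apply: measurable_wrt_ge; exact: aT.
  rewrite (_ : [set _ | _] = ~` [set w | tau w <= ratr q]).
    by apply: salgC => //; exact: htau.
  by apply/seteqP; split=> w /=; rewrite ltNge => /negP.
apply: filterS Tclock => w cw; have [cT T0 inc] := cw.
rewrite /setI /setD /= changed_timeE// inverse_time_change_le//; split.
  move=> [[[Aw ts] tT] nb]; split=> //; split=> //.
  rewrite leNgt; apply/negP => tTt.
  have tau_gt0 : 0 < tau w.
    rewrite lt_neqAle tau0 andbT; apply/eqP => tau00.
    by move: tTt; rewrite -tau00 T0; lra.
  have gap : 0 < T (tau w) w - t by rewrite subr_gt0.
  have [dl dl0 Hd] := cT _ (tau0 w) _ gap.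
  have [q] : exists q : rat, ratr q \in `](Num.max 0 (tau w - dl)), (tau w)[.
    by apply: rat_in_itvoo; rewrite gt_max tau_gt0/= ltrBlDr ltrDl.
  rewrite in_itv/= gt_max => /andP[/andP[q0 qd] qt].
  apply: nb; exists q => //; rewrite (ltW q0) (le_trans (ltW qt) ts)/=; split=> //=.
  have near : `|ratr q - tau w| < dl.
    by rewrite distrC ger0_norm ?subr_ge0 ?(ltW qt)//; lra.
  by have := Hd _ (ltW q0) near; rewrite ltr_norml => /andP[+ _]; lra.
move=> [[Aw Tt] tT]; split; last first.
  case=> q _; case: ifPn => // /andP[q0 qs] [/= tq qtau].
  by have := inc _ _ q0 qtau; lra.
split=> //; split=> //; rewrite leNgt; apply/negP => st.
by have := inc _ _ s0 st; lra.
Qed.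

Lemma truncated_time_stopping tau N : stopping_time H (EFin \o tau) -> 0 <= N ->
  stopping_time G (EFin \o (fun w => Num.min (changed_time tau w) N)).
Proof.
move=> ht N0; apply/stopping_timeP; split=> [w|t t0].
  rewrite le_min N0 andbT; apply: changed_time_ge0.
  by have [] := (stopping_timeP H tau).1 ht.
have [sG _ _] := time_changed_complete t0.
have [Nt|tN] := leP N t.
  rewrite (_ : [set _ | _] = setT); first exact: salgT.
  by apply/seteqP; split=> // w _ /=; rewrite ge_min Nt orbT.
rewrite (_ : [set _ | _] = setT `&` [set w | changed_time tau w <= t]).
  apply: changed_time_le_sigma => //; apply: salgT; apply: (stopped_sigma_algebraP Hc).
  by have [] := (stopping_timeP H tau).1 ht.
by rewrite setTI; apply/seteqP; split=> w /=; rewrite ge_min [N <= t]leNgt tN orbF.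
Qed.

Lemma truncated_gain_eq0 (X : R -> Omega -> R) tau sigma A (e N : R) :
  no_arbitrage P X (simple_strategies G) ->
  (forall s, 0 <= s -> measurable_wrt measurable (X s)) ->
  {ae P, forall w, forall t, 0 <= t -> right_continuous_at (X ^~ w) t} ->
  stopping_time H (EFin \o tau) -> stopping_time H (EFin \o sigma) ->
  (forall w, tau w <= sigma w) -> stopped_sigma_algebra H (EFin \o tau) A ->
  0 <= N -> (e = 1 \/ e = -1) ->
  let V w := X (Num.min (T (sigma w) w) N) w - X (Num.min (T (tau w) w) N) w in
  {ae P, forall w, A w -> 0 <= e * V w} -> {ae P, forall w, A w -> V w = 0}.
Proof.
move=> na mX cX ht hs ts hA N0 e1 V V0.
have [tau0 htau] := (stopping_timeP H tau).1 ht.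
have measurable_complete : complete_subalgebra P (@measurable _ Omega).
  split=> //; first exact: sigma_algebra_measurable.
  by move=> M nM; have [_ Hm H0] := Hc (lexx 0); exact/Hm/H0.
(* At the truncated time, [A] is known only if the position was opened before the cap; otherwise
   both times equal [N] and the gain is 0. *)
pose A' := A `&` [set w | changed_time tau w <= N].
pose ti tau w := Num.min (changed_time tau w) N.
pose h := @Strategy _ Omega R 2 0 (fun _ w => e * \1_A' w)
  (fun j => if j == 1%N then ti tau else ti sigma).
have GA' : G N A' by exact: changed_time_le_sigma.
have mA' : measurable A' by case: GA'.
have hh : simple_strategies G h.
  split=> //=.
  - move=> w; split; first by rewrite /ti le_min N0 andbT changed_time_ge0.
    move=> [//|[|//]] _ /=; rewrite /ti le_min !ge_min lexx orbT andbT.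
    by rewrite changed_time_le.
  - by exists N => w; rewrite /ti ge_min lexx orbT.
  - by move=> j _; case: ifP => _; exact: truncated_time_stopping.
  - move=> [//|[|//]] _ /=.
    have st := truncated_time_stopping ht N0.
    have [_ st'] := (stopping_timeP G _).1 st.
    have sS : sigma_algebra setT (stopped_sigma_algebra G (EFin \o ti tau)).
      by apply: (stopped_sigma_algebraP time_changed_complete).
    apply: measurable_wrtZ => //; apply/measurable_wrtP => //.
    apply: measurable_indic; apply/(sigma_algebra_measurableE _ sS).
    (* For [N <= t] the event [A'] is already in the sigma-algebra at [N]; for [t < N] the cap is
       invisible. *)
    split=> // t t0; have [Nt|tN] := leP N t.
      have [sG _ _] := time_changed_complete t0.
      apply: salgI => //; first exact: time_changed_mono GA'.
      exact: st'.
    rewrite (_ : _ `&` _ = A `&` [set w | changed_time tau w <= t]).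
      exact: changed_time_le_sigma.
    apply/seteqP; split=> w /=; rewrite /A' /= lee_fin ge_min [N <= t]leNgt tN orbF.
      by move=> [[]].
    by move=> [Aw tt]; split=> //; split=> //; apply: le_trans tt (ltW tN).
have gE : {ae P, forall w, terminal_gain h X w = \1_A w * (e * V w)}.
  apply: filterS Tclock => w cw; rewrite /terminal_gain /h /= big_nat1 /=.
  rewrite /ti !changed_timeE// -/(V w) !indicE.
  have [Aw|Aw] := pselect (A w); last first.
    by rewrite !memNset ?mulr0 ?mul0r//; move=> [].
  have [tN|Nt] := leP (T (tau w) w) N.
    by rewrite !mem_set// ?mulr1 ?mul1r//; split=> //=; rewrite changed_timeE.
  suff -> : V w = 0 by rewrite !mulr0.
  rewrite /V !(min_idPr _) ?subrr//; first exact: ltW.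
  apply/ltW/(lt_le_trans Nt); exact: clock_le.
pose f := terminal_gain h X.
have mf : measurable_wrt measurable f.
  have mti rho : stopping_time H (EFin \o rho) -> measurable_wrt measurable (fun w => X (ti rho w) w).
    move=> hr; rewrite (_ : (fun _ => _) = (fun w => X (clamp N (changed_time rho w)) w)).
      apply: (measurable_wrt_random_time (P := P)) => //.
      - by move=> s s0 _; exact: mX.
      - by apply: filterS cX => w cw t t0 _; exact: cw.
      - exact: measurable_changed_time.
    apply/funext => w; congr (X _ w); rewrite /clamp minC /ti.
    rewrite (max_idPr _)// le_min N0 andbT; apply: changed_time_ge0.
    by have [] := (stopping_timeP H rho).1 hr.
  have sM := sigma_algebra_measurable Omega.
  rewrite (_ : f = fun w => (e * \1_A' w) * (X (ti sigma w) w - X (ti tau w) w)).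
    apply: measurable_wrtM => //; last by apply: measurable_wrtB => //; exact: mti.
    apply: measurable_wrtZ => //; move=> B mB; rewrite -[_ @^-1` _]setTI.
    by apply: measurable_indic.
  by apply/funext => w; rewrite /f /terminal_gain big_nat1.
have f0 : L0_nonneg P f.
  split; first by move=> _ B mB; rewrite setTI; exact: mf.
  apply: filterS2 gE V0 => w; rewrite /f => -> V0; rewrite indicE.
  have [Aw|Aw] := pselect (A w); first by rewrite mem_set// mul1r V0.
  by rewrite memNset// mul0r.
have fz : {ae P, forall w, f w = 0}.
  by apply/(na f f0); exists h => //; apply: aeW.
apply: filterS2 gE fz => w + + Aw; rewrite -/f => -> /eqP.
rewrite indicE mem_set// mul1r mulf_eq0 => /orP[|/eqP//].
by case: e1 => ->; rewrite ?oppr_eq0 oner_eq0.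
Qed.

End TimeChangedFiltration.

(** * Completed and augmented sigma-algebras *)

Section CompleteSubalgebras.
Context (d : measure_display) (Omega : measurableType d) (R : realType).
Implicit Types (P : probability Omega R) (K G : set (set Omega)).

Lemma measurable_wrt_of_lt K (f : Omega -> R) : sigma_algebra setT K ->
  (forall c, K [set w | f w < c]) -> measurable_wrt K f.
Proof.
move=> sK Kf; apply: measurable_wrt_of_le => // c.
have := @salg_bigcap _ _ K (fun n => [set w | f w < c + n.+1%:R^-1]) sK (fun n => Kf _).
congr K; apply/seteqP; split=> w /= H.
  apply/ler_addgt0Pr => e e0.
  have [n _ Hn] := near_infty_natSinv_lt (PosNum e0).
  apply/ltW/(lt_trans (H n I)); rewrite ltrD2l; exact: (Hn n (leqnn n)).
by move=> n _ /=; apply: (le_lt_trans H); rewrite ltrDl.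
Qed.

Lemma measurable_wrt_random_time_pos P K (U : R -> Omega -> R)
    (xi : Omega -> R) : complete_subalgebra P K ->
  (forall s, 0 <= s -> measurable_wrt K (U s)) ->
  {ae P, forall w, forall t, 0 <= t -> right_continuous_at (U ^~ w) t} ->
  measurable_wrt K xi -> {ae P, forall w, 0 <= xi w} ->
  measurable_wrt K (fun w => U (xi w) w).
Proof.
move=> cK mU cU mxi xi0; have [sK _ _] := cK.
apply: (@measurable_wrt_ae _ _ _ P K (fun w => U (Num.max 0 (xi w)) w)) => //.
  by apply: filterS xi0 => w xw; rewrite (max_idPr _).
apply/measurable_wrtP => //.
apply: (@measurable_fun_cvg _ _ _ _ (fun n (w : g_sigma_algebraType K) => U (clamp n%:R (xi w)) w : R)).
  move=> n; apply/(measurable_wrtP _ sK); apply: (measurable_wrt_random_time cK) => //.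
    by move=> s s0 _; exact: mU.
  by apply: filterS cU => w cw t t0 _; exact: cw.
move=> w _; apply: cvg_near_cst; exists (Num.truncn (xi w)).+1 => // n /= xn.
rewrite /clamp (min_idPr _)//; apply: ltW; apply: lt_le_trans (truncnS_gt _) _.
by rewrite ler_nat.
Qed.

Lemma complete_generated P G :
  (forall N, P.-negligible N -> measurable N) -> G `<=` measurable ->
  complete_subalgebra P <<s G `|` [set N | P.-negligible N] >>.
Proof.
move=> null_measurable mG; split; first exact: smallest_sigma_algebra.
  apply: smallest_sub; first exact: sigma_algebra_measurable.
  by move=> A [/mG//|/null_measurable].
by move=> N nN; apply: sub_sigma_algebra; right.
Qed.

Lemma complete_augmentation P (Gen : R -> set (set Omega)) t :
  (forall N, P.-negligible N -> measurable N) ->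
  (forall s, t < s -> Gen s `<=` measurable) ->
  complete_subalgebra P (augmentation P Gen t).
Proof.
move=> null_measurable mG; have cG s : t < s ->
    complete_subalgebra P <<s Gen s `|` [set N | P.-negligible N] >>.
  by move=> ts; apply: complete_generated => //; exact: mG.
split.
- by apply: sigma_algebra_bigcap => s /cG[].
- have t1 : t < t + 1 by rewrite ltrDl.
  by have [_ mS _] := cG _ t1; move=> A /(_ _ t1)/mS.
- by move=> N nN s /cG[_ _]; exact.
Qed.

Lemma augmentation_mono P (Gen : R -> set (set Omega)) s t : s <= t ->
  augmentation P Gen s `<=` augmentation P Gen t.
Proof. by move=> st A HA u /= tu; apply: HA => /=; exact: le_lt_trans tu. Qed.

Lemma past_events_measurable (U : R -> Omega -> R) t :
  (forall s, 0 <= s -> measurable_wrt measurable (U s)) ->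
  past_events U t `<=` measurable.
Proof. by move=> mU _ [s /= /andP[s0 _] [A mA <-]]; exact: mU. Qed.

End CompleteSubalgebras.

(** * Linear combinations and clamped levels *)

Section CompoundPaths.
Context (R : realType).
Implicit Types (f g : R -> R).

Lemma continuous_pos_lin (a b : R) f g : continuous_pos f -> continuous_pos g ->
  continuous_pos (fun s => a * f s + b * g s).
Proof.
move=> cf cg t t0 e e0; pose c := `|a| + `|b| + 1.
have c0 : 0 < c by rewrite ltr_wpDl// addr_ge0.
have ec0 : 0 < e / c by rewrite divr_gt0.
have [d1 d10 H1] := cf _ t0 _ ec0; have [d2 d20 H2] := cg _ t0 _ ec0.
exists (Num.min d1 d2); first by rewrite lt_min d10.
move=> s s0; rewrite lt_min => /andP[s1 s2].
rewrite [X in `|X|](_ : _ = a * (f s - f t) + b * (g s - g t)); last first.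
  by rewrite !mulrBr opprD addrACA.
have {}H1 := H1 _ s0 s1; have {}H2 := H2 _ s0 s2.
apply: le_lt_trans (ler_normD _ _) _; rewrite !normrM.
apply: (@le_lt_trans _ _ ((`|a| + `|b|) * (e / c))).
  by rewrite mulrDl lerD// ler_wpM2l// ltW.
rewrite -[ltRHS](divfK (lt0r_neq0 c0)) [ltRHS]mulrC ltr_pM2r//.
by rewrite /c ltrDl.
Qed.

Lemma clamp_lipschitz (m x y : R) : `|clamp m x - clamp m y| <= `|x - y|.
Proof.
rewrite ler_norml /clamp.
have h1 := ler_norm (x - y); have h2 := ler_norm (y - x); rewrite (distrC y x) in h2.
by case: (lerP m x) => ?; case: (lerP m y) => ?; 
  case: (lerP 0 m) => ?; case: (lerP 0 x) => ?; case: (lerP 0 y) => ?; lra.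
Qed.

Lemma clamp_mono (m x y : R) : x <= y -> clamp m x <= clamp m y.
Proof.
by move=> xy; rewrite /clamp; case: (lerP m x) => ?; case: (lerP m y) => ?;
  case: (lerP 0 m) => ?; case: (lerP 0 x) => ?; case: (lerP 0 y) => ?; lra.
Qed.

End CompoundPaths.

(** * Truncating the time-changed gain *)

Section Core.
Context (d : measure_display) (Omega : measurableType d) (R : realType).
Variables (P : probability Omega R) (F : R -> set (set Omega)).
Variables (B W J T : R -> Omega -> R) (rho alpha beta : R).
Hypotheses (hF : filtration F) (F0 : forall N, P.-negligible N -> F 0 N).
Hypotheses (hB : brownian_motion P F B) (hW : brownian_motion P F W).
Hypothesis hBW : independent P (all_events B) (all_events W).
Hypotheses (hJF : adapted F J) (hJ : levy_process P J).
Hypothesis hJm : nondecreasing_paths P J.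
Hypothesis hJBW : independent P (all_events J) (all_events B `|` all_events W).
Hypothesis hrho : -1 <= rho <= 1.
Hypothesis TB : adapted (natural_filtration P B) T.
Hypothesis Tclock : {ae P, forall w, clock T w}.

Local Notation Z := (correlated rho B W).
Local Notation X := (subordinated alpha beta Z J).
Local Notation Y := (time_changed X T).
Local Notation H := (natural_filtration2 P Y T).
Local Notation null := [set N | P.-negligible N].

Let null_measurable N : P.-negligible N -> measurable N.
Proof. by move=> /F0; case: hF => _ h _; exact: h. Qed.

Let measurable_complete : complete_subalgebra P (@measurable _ Omega).
Proof. by split=> //; exact: sigma_algebra_measurable. Qed.

Let measurable_of_adapted U : adapted F U ->
  forall t, 0 <= t -> measurable_wrt measurable (U t).
Proof.
by move=> aU t t0; case: hF => _ h _; apply: measurable_wrtS (h _ t0) _; exact: aU.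
Qed.

Let mB : forall t, 0 <= t -> measurable_wrt measurable (B t).
Proof. by apply: measurable_of_adapted; case: hB. Qed.

Let mW : forall t, 0 <= t -> measurable_wrt measurable (W t).
Proof. by apply: measurable_of_adapted; case: hW. Qed.

Let mJ : forall t, 0 <= t -> measurable_wrt measurable (J t).
Proof. exact: measurable_of_adapted. Qed.

Let mT : forall t, 0 <= t -> measurable_wrt measurable (T t).
Proof.
move=> t t0; have := TB t0; apply: measurable_wrtS.
have [|_ + _] // := @complete_augmentation _ _ _ P (past_events B) t null_measurable.
by move=> s _; exact: past_events_measurable.
Qed.

Definition regular w := [/\ continuous_pos (B ^~ w), continuous_pos (W ^~ w),
  J 0 w = 0 /\ (forall t, 0 <= t -> right_continuous_at (J ^~ w) t),
  (forall s t, 0 <= s -> s <= t -> J s w <= J t w) & clock T w].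

Let regular_ae : {ae P, forall w, regular w}.
Proof.
have cB : {ae P, forall w, continuous_pos (B ^~ w)}.
  by case: hB => _ _ h _ _; apply: filterS h => w; exact: within_continuous_pos.
have cW : {ae P, forall w, continuous_pos (W ^~ w)}.
  by case: hW => _ _ h _ _; apply: filterS h => w; exact: within_continuous_pos.
have cJ : {ae P, forall w, J 0 w = 0 /\ (forall t, 0 <= t -> right_continuous_at (J ^~ w) t)}.
  case: hJ => h0 h1 _ _; apply: filterS2 h0 h1 => w -> [h _]; split=> // t t0.
  exact/cvg_right_continuous_at/h.
have BW : {ae P, forall w, continuous_pos (B ^~ w) /\ continuous_pos (W ^~ w)}.
  by apply: filterS2 cB cW.
have JT : {ae P, forall w, (forall s t, 0 <= s -> s <= t -> J s w <= J t w) /\ clock T w}.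
  by apply: filterS2 hJm Tclock.
by apply: filterS3 BW cJ JT => w [? ?] ? [? ?]; split.
Qed.

Let J_ge0 w s : regular w -> 0 <= s -> 0 <= J s w.
Proof. by move=> [_ _ [J0 _] Jm _] s0; rewrite -J0; exact: Jm. Qed.

Let Z_cont w : regular w -> continuous_pos (Z ^~ w).
Proof. by move=> [cB cW _ _ _]; exact: continuous_pos_lin. Qed.

Let X_right w t : regular w -> 0 <= t -> right_continuous_at (X ^~ w) t.
Proof.
move=> gw t0; have [_ _ [_ rJ] Jm _] := gw.
apply: right_continuous_lin; first exact: rJ.
apply: (@right_continuous_comp _ (Z ^~ w) (J ^~ w)); first exact: rJ.
  by move=> s ts; exact: Jm.
by apply: continuous_pos_right; [exact: Z_cont|exact: J_ge0].
Qed.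

Let Y_right w t : regular w -> 0 <= t -> right_continuous_at (Y ^~ w) t.
Proof.
move=> gw t0; have [_ _ _ _ cw] := gw; have [cT _ _] := cw.
apply: (@right_continuous_comp _ (X ^~ w) (T ^~ w)).
- exact: continuous_pos_right.
- by move=> s ts; exact: clock_le.
- by apply: X_right => //; exact: clock_ge0.
Qed.

Let Z_measurable K t : sigma_algebra setT K ->
  measurable_wrt K (B t) -> measurable_wrt K (W t) -> measurable_wrt K (Z t).
Proof. by move=> sK hb hw; apply: measurable_wrtD => //; exact: measurable_wrtZ. Qed.

Let mX t : 0 <= t -> measurable_wrt measurable (X t).
Proof.
move=> t0; have sM := sigma_algebra_measurable Omega.
apply: measurable_wrtD => //; first by apply: measurable_wrtZ => //; exact: mJ.
apply: measurable_wrtZ => //.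
apply: (measurable_wrt_random_time_pos measurable_complete (U := Z)).
- by move=> s s0; apply: Z_measurable => //; [exact: mB|exact: mW].
- by apply: filterS regular_ae => w gw s s0; apply: continuous_pos_right => //; exact: Z_cont.
- exact: mJ.
- by apply: filterS regular_ae => w gw; exact: J_ge0.
Qed.

Let mY t : 0 <= t -> measurable_wrt measurable (Y t).
Proof.
move=> t0; apply: (measurable_wrt_random_time_pos measurable_complete (U := X)).
- exact: mX.
- by apply: filterS regular_ae => w gw s s0; exact: X_right.
- exact: mT.
- by apply: filterS regular_ae => w [_ _ _ _ cw]; exact: clock_ge0.
Qed.

Let Hgen_measurable t : past_events Y t `|` past_events T t `<=` measurable.
Proof.
by move=> A [hA|hA]; [apply: past_events_measurable hA; exact: mY|
  apply: past_events_measurable hA; exact: mT].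
Qed.

Let Hc t : 0 <= t -> complete_subalgebra P (H t).
Proof. by move=> _; apply: complete_augmentation. Qed.

Let Hmono s t : 0 <= s -> s <= t -> H s `<=` H t.
Proof. by move=> _; exact: augmentation_mono. Qed.

Let YH : adapted H Y.
Proof.
move=> t t0 A mA s /= ts; apply: sub_sigma_algebra; left; left.
by exists t; [rewrite /= t0 ltW|exists A].
Qed.

Let TH : adapted H T.
Proof.
move=> t t0 A mA s /= ts; apply: sub_sigma_algebra; left; right.
by exists t; [rewrite /= t0 ltW|exists A].
Qed.

(** Two horizons: [b] is a level of [J], at which [X] reads [B] and [W], and also a calendar time
    for the clock; [m] is a time of [J]. *)
Definition past_until (b m : R) : set (set Omega) :=
  <<s past_events B b `|` past_events W b `|` past_events J m `|` null >>.

Let past_complete b m : complete_subalgebra P (past_until b m).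
Proof.
apply: complete_generated => // A [[hA|hA]|hA].
- by apply: past_events_measurable hA; exact: mB.
- by apply: past_events_measurable hA; exact: mW.
- by apply: past_events_measurable hA; exact: mJ.
Qed.

Let past_sigma b m : sigma_algebra setT (past_until b m).
Proof. by case: (past_complete b m). Qed.

Let past_B b m s : 0 <= s -> s <= b -> measurable_wrt (past_until b m) (B s).
Proof.
move=> s0 sb A mA; apply: sub_sigma_algebra; left; left; left.
by exists s; [rewrite /= s0|exists A].
Qed.

Let past_W b m s : 0 <= s -> s <= b -> measurable_wrt (past_until b m) (W s).
Proof.
move=> s0 sb A mA; apply: sub_sigma_algebra; left; left; right.
by exists s; [rewrite /= s0|exists A].
Qed.

Let past_J b m s : 0 <= s -> s <= m -> measurable_wrt (past_until b m) (J s).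
Proof.
move=> s0 sm A mA; apply: sub_sigma_algebra; left; right.
by exists s; [rewrite /= s0|exists A].
Qed.

(** The inequality [s < b] is strict because the augmented filtration of [B] at [s] looks slightly
    beyond [s]. *)
Let past_T b m s : 0 <= s -> s < b -> measurable_wrt (past_until b m) (T s).
Proof.
move=> s0 sb; apply: measurable_wrtS (TB s0) => A /(_ _ sb) hA.
apply: sub_sigma_algebra2 hA => C [hC|hC]; last by right.
by left; left; left.
Qed.

Let past_Z b m s : 0 <= s -> s <= b -> measurable_wrt (past_until b m) (Z s).
Proof. by move=> s0 sb; apply: Z_measurable => //; [exact: past_B|exact: past_W]. Qed.

Let past_Z_at b m (xi : Omega -> R) : 0 <= b -> measurable_wrt (past_until b m) xi ->
  measurable_wrt (past_until b m) (fun w => Z (clamp b (xi w)) w).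
Proof.
move=> b0 mxi; apply: (measurable_wrt_random_time (past_complete b m) (U := Z)) => //.
  by move=> s s0 sb; exact: past_Z.
by apply: filterS regular_ae => w gw s s0 _; apply: continuous_pos_right => //; exact: Z_cont.
Qed.

(* Agrees with [X s] as long as [J s <= b], and only looks at the driving
   Brownian motions up to time [b]. *)
Let xhat b s w := alpha * J s w + beta * Z (clamp b (J s w)) w.

Let xhatE b s w : regular w -> 0 <= s -> J s w <= b -> xhat b s w = X s w.
Proof. by move=> gw s0 sb; rewrite /xhat clamp_id// J_ge0. Qed.

Let past_xhat b m (N : R) (xi : Omega -> R) : 0 <= b -> 0 <= N -> N <= m ->
  measurable_wrt (past_until b m) xi ->
  measurable_wrt (past_until b m) (fun w => xhat b (clamp N (xi w)) w).
Proof.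
move=> b0 N0 Nm mxi; apply: (measurable_wrt_random_time (past_complete b m) (U := xhat b)) => //.
  move=> s s0 sN; have mJs : measurable_wrt (past_until b m) (J s).
    by apply: past_J => //; exact: le_trans Nm.
  apply: measurable_wrtD => //; first exact: measurable_wrtZ.
  by apply: measurable_wrtZ => //; exact: past_Z_at.
apply: filterS regular_ae => w gw t t0 _; have [_ _ [_ rJ] Jm _] := gw.
apply: right_continuous_lin; first exact: rJ.
apply: (@right_continuous_comp _ (Z ^~ w) (fun s => clamp b (J s w))).
- move=> e e0; have [dl dl0 Hd] := rJ _ t0 _ e0; exists dl => // s ts st.
  by apply: le_lt_trans (clamp_lipschitz _ _ _) _; exact: Hd.
- by move=> s ts; apply: clamp_mono; exact: Jm.
- by apply: continuous_pos_right; [exact: Z_cont|exact: clamp_ge0].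
Qed.

(** * Events before the clock reaches [N], seen from the past of the drivers *)

Section Localisation.
Variables (b b' m N : R).
Hypotheses (b0 : 0 <= b) (bb' : b <= b') (N0 : 0 <= N) (Nm : N <= m).
Local Notation K := (past_until b' m).

Let b'0 : 0 <= b'. Proof. exact: le_trans bb'. Qed.

Let window : set Omega := [set w | J N w < b].

Let past_window : K window.
Proof. by apply: measurable_wrt_lt; exact: past_J. Qed.

(* Before the clock reaches [N], and as long as [J N < b], the time-changed
   information is contained in the past of [B], [W] up to [b'] and of [J] up to
   [m]. *)
Let past_of_generated s E : 0 <= s -> s < b' ->
  <<s past_events Y s `|` past_events T s `|` null >> E ->
  K (E `&` [set w | T s w < N] `&` window).
Proof.
move=> s0 sb'; pose D := [set w | T s w < N] `&` window.
have sK := past_sigma b' m; have [_ _ nK] := past_complete b' m.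
have KD : K D by apply: (salgI sK) => //; apply: measurable_wrt_lt; exact: past_T.
(* The events whose trace on [D] lies in [K] form a sigma-algebra, so only generators need
   checking. *)
suff : <<s past_events Y s `|` past_events T s `|` null >> `<=` [set A | K (A `&` D)].
  by move=> h /h /=; rewrite -setIA.
apply: smallest_sub.
  split => /=.
  - by rewrite set0I; exact: (salg0 sK).
  - move=> A KA; rewrite (_ : _ `&` D = D `\` (A `&` D)); first exact: (salgD sK).
    by apply/seteqP; split=> w; rewrite /setI /setD /=; tauto.
  - by move=> A KA; rewrite setI_bigcupl; exact: (salg_bigcup sK).
move=> A [[|]|nA] /=; last by apply: nK; apply: negligibleS nA => w [].
  move=> [r /= /andP[r0 rs] [A' mA' <-]].
  have rb' : r < b' by exact: le_lt_trans sb'.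
  apply: (complete_subalgebra_ae (past_complete b' m)
     (A := (fun w => xhat b' (clamp N (T r w)) w) @^-1` A' `&` D)); last first.
    by apply: (salgI sK) => //; apply: (past_xhat b'0 N0 Nm) => //; exact: past_T.
  apply: filterS regular_ae => w gw; have [_ _ _ Jm cw] := gw.
  have TrN : T s w < N -> 0 <= T r w <= N.
    by move=> TN; rewrite clock_ge0//= (le_trans (clock_le cw r0 rs))// ltW.
  have JN : T s w < N -> J N w < b -> J (T r w) w <= b'.
    move=> TN JNb; have /andP[Tr0 TrN'] := TrN TN.
    by apply: le_trans (Jm _ _ Tr0 TrN') _; apply: le_trans bb'; exact: ltW.
  have xE : D w -> xhat b' (clamp N (T r w)) w = Y r w.
    move=> [/= TN JNb]; rewrite clamp_id ?TrN// xhatE//; last exact: JN.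
    by case/andP: (TrN TN).
  by split=> -[/= hA Dw]; split=> //; move: hA; rewrite /= xE.
move=> [r /= /andP[r0 rs] [A' mA' <-]]; apply: (salgI sK) => //.
by apply: (past_T (b := b') (m := m) r0) => //; exact: le_lt_trans sb'.
Qed.

(** The augmentation puts [E] in the information at each [s n > q]; by continuity the clock is still
    below [N] at some [s n]. The denominators start at 2 to keep [s n] strictly below [b']. *)
Let past_of_filtration q E : 0 <= q -> q + 1 <= b' -> H q E ->
  K (E `&` [set w | T q w < N] `&` window).
Proof.
move=> q0 qb' HE; have sK := past_sigma b' m; pose s n : R := q + n.+2%:R^-1.
have qs n : q < s n by rewrite ltrDl.
have sb' n : s n < b'.
  by apply: lt_le_trans qb'; rewrite ltrD2l invf_lt1// ltr1n.
apply: (complete_subalgebra_ae (past_complete b' m)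
  (A := \bigcup_n (E `&` [set w | T (s n) w < N] `&` window))); last first.
  apply: (salg_bigcup sK) => // n; apply: past_of_generated => //; last exact: (HE _ (qs n)).
  exact: le_trans q0 (ltW (qs n)).
apply: filterS regular_ae => w [_ _ _ _ cw]; have [cT _ inc] := cw; split.
  move=> [n _ [[Ew /= Tn] Qw]]; split=> //; split=> //=.
  by apply: lt_trans Tn; exact: inc.
move=> [[Ew /= Tq] Qw].
have gap : 0 < N - T q w by rewrite subr_gt0.
have [dl dl0 Hd] := cT _ q0 _ gap.
have [n _ Hn] := near_infty_natSinv_lt (PosNum dl0).
exists n => //; split=> //; split=> //=.
have := Hd (s n) (le_trans q0 (ltW (qs n))).
have -> : s n - q = n.+2%:R^-1 by rewrite /s addrAC subrr add0r.
rewrite ger0_norm ?invr_ge0// => /(_ (Hn n.+1 (leqnSn n))).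
by rewrite ltr_norml => /andP[_]; rewrite ltrD2r.
Qed.

(** The time [tau] is replaced by a slightly later rational time, at most [kap + 1], and
    [past_of_filtration] asks for one more unit. *)
Lemma past_until_before (tau : Omega -> R) (kap x : R) A :
  stopping_time H (EFin \o tau) -> (forall w, tau w <= kap) -> kap + 2 <= b' ->
  stopped_sigma_algebra H (EFin \o tau) A -> x <= N ->
  K (A `&` [set w | T (tau w) w < x] `&` window).
Proof.
move=> ht tk kb' [mA hA] xN; have sK := past_sigma b' m.
have [tau0 _] := (stopping_timeP H tau).1 ht.
pose D (q : rat) : set Omega := if 0 <= (ratr q : R) <= kap + 1 then
  (A `&` [set w | tau w <= ratr q]) `&` [set w | T (ratr q) w < N] `&` window
  `&` [set w | T (ratr q) w < x] else set0.
apply: (complete_subalgebra_ae (past_complete b' m) (A := \bigcup_q D q)); last first.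
  apply: (salg_bigcup_rat sK) => // q; rewrite /D; case: ifPn => [/andP[q0 qk]|_]; last exact: (salg0 sK).
  apply: (salgI sK) => //.
    by apply: past_of_filtration => //; [lra|exact: hA].
  by apply: measurable_wrt_lt; apply: past_T => //; lra.
apply: filterS regular_ae => w [_ _ _ _ cw]; have [cT _ inc] := cw; split.
  move=> [q _]; rewrite /D; case: ifPn => // /andP[q0 qk].
  move=> [[[[Aw /= tq] _] Qw] Tq]; split=> //; split=> //=.
  by apply: le_lt_trans Tq; exact: clock_le.
move=> [[Aw /= Tx] Qw].
have gap : 0 < x - T (tau w) w by rewrite subr_gt0.
have [dl dl0 Hd] := cT _ (tau0 w) _ gap.
have [q] : exists q : rat, ratr q \in `](tau w), (Num.min (tau w + dl) (kap + 1))[.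
  by apply: rat_in_itvoo; rewrite lt_min ltrDl dl0/=; have := tk w; lra.
rewrite in_itv/= lt_min => /andP[tq /andP[qd qk]].
have q0 : 0 <= ratr q :> R by exact: le_trans (tau0 w) (ltW tq).
exists q => //; rewrite /D q0 (ltW qk)/=.
have qnear : `|ratr q - tau w| < dl by rewrite ger0_norm ?subr_ge0 ?(ltW tq)// ltrBlDl.
have Tqx : T (ratr q) w < x.
  by have := Hd _ q0 qnear; rewrite ltr_norml => /andP[_]; rewrite ltrD2r.
by split=> //; split=> //; split; [split=> //; exact: ltW|exact: lt_le_trans xN].
Qed.

Definition crossing (tau sigma : Omega -> R) (A : set Omega) (e kap delta M : R) :=
  A `&` [set w | T (tau w) w < N /\ N <= T (sigma w) w]
    `&` [set w | e * (X N w - X (T (tau w) w) w) <= - delta]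
    `&` [set w | T kap w <= M].

(** Between [J N] and [b] the Brownian motions already belong to the past, so independence cannot
    control them; this event does. Rational levels make it a countable intersection. *)
Definition near_level (a dl : R) : set Omega :=
  [set w | a <= J N w /\ forall q : rat, 0 <= (ratr q : R) <= b ->
     J N w <= ratr q -> `|Z (ratr q) w - Z (J N w) w| <= dl].

Lemma past_until_crossing tau sigma A (e kap delta M a dl : R) :
  stopping_time H (EFin \o tau) -> stopping_time H (EFin \o sigma) ->
  (forall w, tau w <= kap) -> (forall w, sigma w <= kap) ->
  0 <= kap -> kap + 2 <= b' ->
  stopped_sigma_algebra H (EFin \o tau) A ->
  K (crossing tau sigma A e kap delta M `&` window `&` near_level a dl).
Proof.
move=> ht hs tk sk k0 kb' hA; have sK := past_sigma b' m.
have hT zeta : stopping_time H (EFin \o zeta) -> stopped_sigma_algebra H (EFin \o zeta) setT.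
  move=> hr; apply: salgT; apply: (stopped_sigma_algebraP Hc).
  by have [] := (stopping_timeP H zeta).1 hr.
have K1 := past_until_before ht tk kb' hA (lexx N).
have K2 := past_until_before hs sk kb' (hT _ hs) (lexx N).
(* [T tau] is measurable for the past only on this event; the default [N] makes [xi] measurable
   everywhere. *)
pose xi w := if `[< T (tau w) w < N /\ window w >] then T (tau w) w else N.
have mxi : measurable_wrt K xi.
  apply: measurable_wrt_of_lt => // c; have [cN|Nc] := leP c N.
    rewrite (_ : [set _ | _] = setT `&` [set w | T (tau w) w < c] `&` window).
      exact: (past_until_before ht tk kb' (hT _ ht)).
    apply/seteqP; split=> w; rewrite /xi /=; case: asboolP => // h.
    - by case: h => _ ?; split.
    - by rewrite ltNge cN.
    - by move=> [[_ ?] _].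
    - by move=> [[_ /= tc] Qw]; exfalso; apply: h; split=> //; exact: lt_le_trans cN.
  rewrite (_ : [set _ | _] = setT); first exact: (salgT sK).
  apply/seteqP; split=> // w _ /=; rewrite /xi; case: asboolP => // -[h _].
  exact: lt_trans Nc.
have mxN : measurable_wrt K (fun w => xhat b' (clamp N N) w).
  by apply: (past_xhat b'0 N0 Nm (xi := cst N)); exact: measurable_wrt_cst.
have mxx := past_xhat b'0 N0 Nm mxi.
have K3 : K [set w | e * (xhat b' (clamp N N) w - xhat b' (clamp N (xi w)) w) <= - delta].
  apply: (measurable_wrt_le (f := fun w => e * (xhat b' (clamp N N) w - xhat b' (clamp N (xi w)) w))).
  by apply: measurable_wrtZ => //; exact: measurable_wrtB.
have K4 : K [set w | T kap w <= M].
  by apply: measurable_wrt_le; apply: past_T => //; lra.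
have mJN : measurable_wrt K (J N) by exact: past_J.
have K5 : K [set w | a <= J N w] by exact: measurable_wrt_ge.
(* The clamp makes [Z] at the level [J N] measurable for the past, and does nothing inside the
   window. *)
pose O (q : rat) : set Omega := [set w | 0 <= (ratr q : R) <= b ->
  (~` [set w | J N w <= ratr q] `|`
   [set w | `|Z (ratr q) w - Z (clamp b' (J N w)) w| <= dl]) w].
have K6 : K (\bigcap_q O q).
  apply: (salg_bigcap_rat sK) => // q; apply: (salg_imply sK) => // /andP[q0 qb].
  apply: (salgU sK) => //; first by apply: (salgC sK) => //; exact: measurable_wrt_le.
  apply: (measurable_wrt_le (f := fun w => `|Z (ratr q) w - Z (clamp b' (J N w)) w|)).
  apply: (measurable_wrt_comp (h := Num.Def.normr)); first exact: normr_measurable.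
  apply: measurable_wrtB => //; last exact: past_Z_at.
  by apply: past_Z => //; exact: le_trans bb'.
apply: (complete_subalgebra_ae (past_complete b' m) (A :=
  ((A `&` [set w | T (tau w) w < N] `&` window) `\`
     (setT `&` [set w | T (sigma w) w < N] `&` window)) `&`
  [set w | e * (xhat b' (clamp N N) w - xhat b' (clamp N (xi w)) w) <= - delta] `&`
  [set w | T kap w <= M] `&` [set w | a <= J N w] `&` \bigcap_q O q)); last first.
  do 4 (apply: (salgI sK) => //); exact: (salgD sK).
have [tau0 _] := (stopping_timeP H tau).1 ht.
apply: filterS regular_ae => w gw; have [_ _ _ Jm cw] := gw.
have xE : T (tau w) w < N -> window w ->
    xhat b' (clamp N N) w - xhat b' (clamp N (xi w)) w = X N w - X (T (tau w) w) w.
  move=> tN Qw; have Tt0 : 0 <= T (tau w) w by exact: clock_ge0.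
  have JNb' : J N w <= b' by apply: le_trans bb'; exact: ltW.
  rewrite /xi asboolT// !clamp_id ?lexx ?N0 ?Tt0 ?(ltW tN)//.
  by rewrite !xhatE//; apply: le_trans JNb'; apply: Jm => //; exact: ltW.
have JE : window w -> clamp b' (J N w) = J N w.
  by move=> Qw; rewrite clamp_id// J_ge0//=; apply: le_trans bb'; exact: ltW.
split.
  move=> [[[[[[[Aw /= tN] Qw] ns] hx] TM] aJ] hO].
  split; last first.
    split=> // q qb Jq; have := hO q I qb; rewrite /= JE// => -[|//].
    by move/(_ Jq).
  split=> //; split=> //; split; last by rewrite /= -xE.
  split=> //=; split=> //; rewrite leNgt; apply/negP => sN.
  by apply: ns; split.
move=> [[[[[Aw /= [tN Ns]] hx] TM] Qw] [aJ hO]].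
split; last first.
  move=> q _ qb; rewrite /= JE//; have [Jq|Jq] := pselect (J N w <= ratr q).
    by right; exact: hO.
  by left.
split=> //; split=> //; split; last by rewrite /= xE.
by split=> //; move=> [[_ /=]]; rewrite ltNge Ns.
Qed.

Lemma near_level_le a dl w r : regular w -> window w -> near_level a dl w ->
  J N w <= r <= b -> `|Z r w - Z (J N w) w| <= dl.
Proof.
move=> gw Qw [_ hO] /andP[Jr rb]; have cZ := Z_cont gw.
have J0 : 0 <= J N w by exact: J_ge0.
have r0 : 0 <= r by exact: le_trans Jr.
apply/ler_addgt0Pr => e e0; have [dd dd0 Hd] := cZ _ r0 _ e0.
have [q] : exists q : rat,
    ratr q \in `](Num.max (J N w) (r - dd)), (Num.min (r + dd) b)[.
  by apply: rat_in_itvoo; rewrite lt_min !gt_max -!andbA; apply/and4P; split;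
    have := Qw; rewrite /window /=; lra.
rewrite in_itv/= gt_max lt_min => /andP[/andP[q1 q2] /andP[q3 q4]].
have q0 : 0 <= ratr q :> R by exact: le_trans J0 (ltW q1).
have h1 : `|Z (ratr q) w - Z (J N w) w| <= dl.
  by apply: hO; rewrite ?q0 ?ltW.
have h2 : `|Z (ratr q) w - Z r w| < e.
  by apply: Hd => //; rewrite ltr_norml; apply/andP; split; lra.
apply: le_trans (ler_distD (Z (ratr q) w) _ _) _; rewrite addrC lerD//.
by rewrite distrC ltW.
Qed.

End Localisation.

(** [P (E & D)] is the product of [P E] and [P D], and the second factor is positive. *)
Let negligible_of_independent (K : set (set Omega)) E D : complete_subalgebra P K ->
  independent_event P K D -> K E -> measurable D -> (0 < P D)%E ->
  P.-negligible (E `&` D) -> P.-negligible E.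
Proof.
move=> [_ Km _] iD KE mD D0 nED; have mE := Km _ KE.
have := measure_negligible (measurableI _ _ mE mD) nED.
rewrite [LHS](iD _ KE) => /eqP; rewrite mule_eq0 => /orP[/eqP E0|/eqP D00].
  exact/negligibleP.
by move: D0; rewrite D00 ltxx.
Qed.

Let past_all (U : R -> Omega -> R) (t : R) : <<s past_events U t >> `<=` <<s all_events U >>.
Proof.
by apply: sub_sigma_algebra2 => A [s /= /andP[s0 _] hA]; exists s.
Qed.

Let past_F (U : R -> Omega -> R) (b : R) : adapted F U -> 0 <= b -> <<s past_events U b >> `<=` F b.
Proof.
move=> aU b0; case: hF => sF _ mono; apply: smallest_sub; first exact: sF.
move=> _ [s /= /andP[s0 sb] [A mA <-]]; apply: (mono _ _ s0 sb); exact: aU.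
Qed.

(** The pair of [B] and [W] is split off from the whole of [J], so the level [b] is arbitrary; the
    Levy property handles the past of [J]. *)
Let independent_J_increment (b N M kap : R) : 0 <= N -> N < M ->
  independent_event P (past_until b N) [set w | J M w - J N w < kap].
Proof.
move=> N0 NM; set D := [set w | _].
have M0 : 0 <= M by rewrite (le_trans N0)// ltW.
have eD : events_of (fun w => J M w - J N w) D.
  exists `]-oo, kap[%classic; first exact: measurable_itv.
  by apply/seteqP; split=> w /=; rewrite in_itv.
have sJ := smallest_sigma_algebra setT (all_events J).
have JD : <<s all_events J >> D.
  have aJ s : 0 <= s -> measurable_wrt <<s all_events J >> (J s).
    by move=> s0 A mA; apply: sub_sigma_algebra; exists s => //; exists A.
  by apply: (measurable_wrt_lt (f := fun w => J M w - J N w)); apply: measurable_wrtB => //; exact: aJ.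
apply: independent_event_join3 => //.
- by apply: (measurable_wrt_lt (f := fun w => J M w - J N w));
    apply: measurable_wrtB; [exact: sigma_algebra_measurable|exact: mJ|exact: mJ].
- exact: past_events_measurable.
- exact: past_events_measurable.
- exact: past_events_measurable.
- move=> A1 A2 A3 h1 h2 h3.
  have h12 : <<s all_events B `|` all_events W >> (A1 `&` A2).
    apply: generatedI.
      by apply: sub_sigma_algebra2 (past_all h1) => A; left.
    by apply: sub_sigma_algebra2 (past_all h2) => A; right.
  have h3' := past_all h3.
  have levy : P (A3 `&` D) = (P A3 * P D)%E.
    by case: hJ => _ _ hi _; apply: (hi _ _ N0 NM) => //; exact: sub_sigma_algebra.
  rewrite -setIA [LHS](_ : _ = P ((A3 `&` D) `&` (A1 `&` A2))); last by rewrite setIC.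
  rewrite (hJBW (generatedI h3' JD) h12) levy (setIC (A1 `&` A2)).
  by rewrite (hJBW h3' h12) muleAC.
Qed.

(** The part from [J] is split off, so its horizon [m] is arbitrary; [B] is then separated from [W],
    and each barrier from the past of its own motion. *)
Let independent_barriers (b m : R) D1 D2 : 0 <= b ->
  <<s all_events B >> D1 -> independent_event P (F b) D1 ->
  <<s all_events W >> D2 -> independent_event P (F b) D2 ->
  independent_event P (past_until b m) (D1 `&` D2).
Proof.
move=> b0 h1 i1 h2 i2.
have mD1 : measurable D1.
  move: D1 h1 {i1}; apply: smallest_sub; first exact: sigma_algebra_measurable.
  by move=> _ [s s0 [A mA <-]]; exact: mB.
have mD2 : measurable D2.
  move: D2 h2 {i2}; apply: smallest_sub; first exact: sigma_algebra_measurable.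
  by move=> _ [s s0 [A mA <-]]; exact: mW.
apply: independent_event_join3 => //.
- exact: measurableI.
- exact: past_events_measurable.
- exact: past_events_measurable.
- exact: past_events_measurable.
- move=> A1 A2 A3 a1 a2 a3.
  have a1' := past_all a1; have a2' := past_all a2; have a3' := past_all a3.
  have BW1 C1 : <<s all_events B >> C1 -> <<s all_events B `|` all_events W >> C1.
    by apply: sub_sigma_algebra2 => A; left.
  have BW2 C2 : <<s all_events W >> C2 -> <<s all_events B `|` all_events W >> C2.
    by apply: sub_sigma_algebra2 => A; right.
  have FA1 : F b A1 by apply: past_F a1 => //; case: hB.
  have FA2 : F b A2 by apply: past_F a2 => //; case: hW.
  have -> : A1 `&` A2 `&` A3 `&` (D1 `&` D2) = A3 `&` ((A1 `&` D1) `&` (A2 `&` D2)).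
    by apply/seteqP; split=> w; rewrite /setI /=; tauto.
  have BW1' := BW1 _ (generatedI a1' h1); have BW2' := BW2 _ (generatedI a2' h2).
  rewrite (hJBW a3' (generatedI BW1' BW2')).
  rewrite (hBW (generatedI a1' h1) (generatedI a2' h2)) (i1 _ FA1) (i2 _ FA2).
  rewrite (setIC (A1 `&` A2)) (hJBW a3' (generatedI (BW1 _ a1') (BW2 _ a2'))).
  by rewrite (hBW a1' a2') (hBW h1 h2) -[RHS]muleA muleACA.
Qed.

(** * A losing position that is open at time [N] *)

Section Crossing.
Variables (tau sigma : Omega -> R) (A : set Omega) (e kap : R).
Hypotheses (ht : stopping_time H (EFin \o tau)) (hs : stopping_time H (EFin \o sigma)).
Hypotheses (ts : forall w, tau w <= sigma w) (sk : forall w, sigma w <= kap).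
Hypotheses (hA : stopped_sigma_algebra H (EFin \o tau) A) (e1 : e = 1 \/ e = -1).
Hypothesis gain : {ae P, forall w, A w -> 0 <= e * (Y (sigma w) w - Y (tau w) w)}.

Let tau0 w : 0 <= tau w. Proof. by have [] := (stopping_timeP H tau).1 ht. Qed.

Let kap0 : 0 <= kap.
Proof. by apply: le_trans (tau0 point) _; apply: le_trans (ts point) _. Qed.

Let tk w : tau w <= kap. Proof. exact: le_trans (ts w) (sk w). Qed.

Section AtTime.
Variables (N M delta a h dl : R).
Hypotheses (N0 : 0 <= N) (NM : N < M) (a0 : 0 <= a) (h0 : 0 < h) (dl0 : 0 < dl).
(** The drift moves by at most the first term while [J] climbs to [b]. One [dl] is for [Z] on that
    stretch, two bound the slack of the barriers for [B] and [W]. *)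
Hypothesis small : `|alpha| * (2 * h) + 3 * (`|beta| * dl) < delta.
(** [near_crossing] puts [J N] in [[a, a + h)], so [J] can still grow by [h] without passing [b]. *)
Let b := a + 2 * h.

Let b0 : 0 <= b. Proof. by rewrite addr_ge0// mulr_ge0// ltW. Qed.

(* A one-step position that straddles the time [N] of [X] and has lost at least
   [delta] by then.  To be an almost surely nonnegative gain it must recover
   between [N] and [T kap <= M], which the next two lemmas exclude. *)
Definition near_crossing := crossing N tau sigma A e kap delta M
  `&` [set w | J N w < b] `&` near_level b N a dl `&` [set w | J N w < a + h].

Let past_near_crossing (b' m : R) : b <= b' -> kap + 2 <= b' -> N <= m -> past_until b' m near_crossing.
Proof.
move=> bb' kb' Nm; apply: (salgI (past_sigma b' m)).
  exact: (past_until_crossing b0 bb' N0 Nm).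
by apply: measurable_wrt_lt; exact: past_J.
Qed.

(** The position closes at a time of [X] between [N] and [M]; a recovery smaller than [delta] leaves
    the total gain negative. *)
Let near_crossing_stays w : regular w ->
  (A w -> 0 <= e * (Y (sigma w) w - Y (tau w) w)) -> near_crossing w ->
  (forall u, N <= u -> u <= M -> e * (X u w - X N w) < delta) -> False.
Proof.
move=> gw gA [[[[[[Aw /= [tN Ns]] hx] TM] Qw] hO] Jh] Hu.
have [_ _ _ _ cw] := gw.
have sM : T (sigma w) w <= M.
  by apply: le_trans TM; apply: clock_le => //; exact: le_trans (ts w).
have h1 := Hu _ Ns sM; have h2 := gA Aw.
move: h1 h2 hx; rewrite /time_changed /= !mulrBr.
by move: (e * _) (e * _) (e * _) => x y z; lra.
Qed.

Let near_crossing_move w j : regular w -> near_crossing w -> J N w <= j <= b ->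
  e * (alpha * (j - J N w) + beta * (Z j w - Z (J N w) w)) <=
    `|alpha| * (2 * h) + `|beta| * dl.
Proof.
move=> gw [[[_ Qw] hO] Jh] jb.
have hZ := near_level_le N0 gw Qw hO jb.
have eN : `|e| = 1 by case: e1 => ->; rewrite ?normrN normr1.
apply: le_trans (ler_norm _) _; rewrite normrM eN mul1r.
apply: le_trans (ler_normD _ _) _; rewrite !normrM lerD// ler_wpM2l//.
case/andP: jb => j1 j2; rewrite ger0_norm ?subr_ge0//.
by case: hO => aJ _; move: j2; rewrite /b; lra.
Qed.

(* With positive probability [J], whose increment is independent of the past,
   hardly moves on [N, M]. *)
Lemma near_crossing_negligible_slow :
  (forall m eta : R, 0 <= m -> 0 < eta -> (0 < P [set w | (J m w < eta)%R])%E) ->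
  P.-negligible near_crossing.
Proof.
(* The past must reach [kap + 2] to contain the clock. Enlarging it is harmless here, the
   independent event concerning [J] alone. *)
move=> slow; pose b' := Num.max b (kap + 2).
have bb' : b <= b' by rewrite le_max lexx.
have kb' : kap + 2 <= b' by rewrite le_max lexx orbT.
pose D := [set w | J M w - J N w < h].
have mD : measurable D.
  apply: (measurable_wrt_lt (f := fun w => J M w - J N w)); apply: measurable_wrtB.
  - exact: sigma_algebra_measurable.
  - by apply: mJ; rewrite (le_trans N0)// ltW.
  - exact: mJ.
refine (negligible_of_independent (past_complete b' N)
  (@independent_J_increment b' N M h N0 NM) (past_near_crossing bb' kb' (lexx N)) mD _ _).
  have MN : 0 <= M - N by rewrite subr_ge0 ltW.
  have -> : P D = P [set w | J (M - N) w < h]; last exact: slow.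
  case: hJ => _ _ _ hst.
  have := hst _ _ N0 NM `]-oo, h[%classic (measurable_itv _).
  by congr (P _ = P _); apply/seteqP; split=> w /=; rewrite in_itv.
apply: negligibleS (negligibleU regular_ae gain) => w [nw Dw].
have [gw|] := pselect (regular w); last by left.
right => gA; apply: (near_crossing_stays gw gA nw) => u Nu uM.
have [_ _ _ Jm _] := gw.
have J1 := Jm _ _ N0 Nu; have J2 := Jm _ _ (le_trans N0 Nu) uM.
have jb : J N w <= J u w <= b.
  rewrite J1/= /b; case: nw => _ /=; move: Dw; rewrite /D /=; lra.
have := near_crossing_move gw nw jb.
have -> : alpha * (J u w - J N w) + beta * (Z (J u w) w - Z (J N w) w) = X u w - X N w.
  by rewrite /subordinated !mulrBr opprD addrACA.
move=> /le_lt_trans; apply; apply: le_lt_trans small; rewrite lerD2l.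
by rewrite ler_peMl// ?ler1n// mulr_ge0// ltW.
Qed.

(* [T kap] only depends on [B] up to time [kap], which [J] has passed at time
   [N]: the increments of [B] and [W] after [b] are independent of the clock,
   and may stay below a barrier that offsets the drift [alpha]. *)
Lemma near_crossing_negligible_fast (c : R) : 0 <= c -> `|alpha| <= c * `|beta| ->
  {ae P, forall w, kap + 2 <= J N w} -> P.-negligible near_crossing.
Proof.
move=> c0 hc fast.
(* The window forces [J N < b]; so if [b] is below [kap + 2] the event is null, and otherwise [b] is
   itself a sufficient horizon. *)
have [kb|bk] := leP (kap + 2) b; last first.
  apply: negligibleS fast => w [[[_ /= Qw] _] _] /= kJ.
  by move: (le_lt_trans kJ (lt_trans Qw bk)); rewrite ltxx.
(* [eB] is the sign of [e * beta * rho]: a barrier for [eB] times the increment of [B] bounds its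
   contribution to the gain. *)
have [eB [eB1 eBE]] : exists eB, (eB = 1 \/ eB = -1) /\ e * beta * rho = eB * `|beta * rho|.
  have [p|p] := leP 0 (e * beta * rho).
    exists 1; split; [by left|]; rewrite mul1r -(ger0_norm p) -mulrA normrM.
    by case: e1 => ->; rewrite ?normrN normr1 mul1r.
  exists (-1); split; [by right|]; rewrite mulN1r -[LHS]opprK -(ltr0_norm p) -mulrA normrM.
  by case: e1 => ->; rewrite ?normrN normr1 mul1r.
pose s := Num.sqrt (1 - rho ^+ 2).
have s0 : 0 <= s by rewrite sqrtr_ge0.
have ss : s ^+ 2 = 1 - rho ^+ 2.
  by rewrite sqr_sqrtr//; case/andP: hrho => ? ?; nra.
have [eW [eW1 eWE]] : exists eW, (eW = 1 \/ eW = -1) /\ e * beta * s = eW * `|beta * s|.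
  have [p|p] := leP 0 (e * beta * s).
    exists 1; split; [by left|]; rewrite mul1r -(ger0_norm p) -mulrA normrM.
    by case: e1 => ->; rewrite ?normrN normr1 mul1r.
  exists (-1); split; [by right|]; rewrite mulN1r -[LHS]opprK -(ltr0_norm p) -mulrA normrM.
  by case: e1 => ->; rewrite ?normrN normr1 mul1r.
(* Whatever the correlation, the two barriers together have slope at least [c * |beta|], which
   dominates the drift. *)
have rs : 1 <= `|rho| + s.
  have r1 : `|rho| <= 1 by rewrite ler_norml.
  have r2 : `|rho| ^+ 2 = rho ^+ 2 by rewrite real_normK ?num_real.
  have r0 := normr_ge0 rho; nra.
(* A barrier has finite length while [J M] is unbounded, hence a countable cut by the size of
   [J M]. *)
have Lneg (L : nat) : P.-negligible (near_crossing `&` [set w | J M w <= b + L.+1%:R]).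
  have L0 : (0 : R) < L.+1%:R by [].
  have [D1 [hD1 iD1 pD1 bD1]] := brownian_barrier hF hB eB1 c0 dl0 b0 L0.
  have [D2 [hD2 iD2 pD2 bD2]] := brownian_barrier hF hW eW1 c0 dl0 b0 L0.
  have PD : P (D1 `&` D2) = (P D1 * P D2)%E by exact: hBW.
  have mD : measurable (D1 `&` D2).
    apply: measurableI.
      move: D1 hD1 {iD1 pD1 bD1 PD}; apply: smallest_sub; first exact: sigma_algebra_measurable.
      by move=> _ [t t0 [C mC <-]]; exact: mB.
    move: D2 hD2 {iD2 pD2 bD2 PD}; apply: smallest_sub; first exact: sigma_algebra_measurable.
    by move=> _ [t t0 [C mC <-]]; exact: mW.
  have KE : past_until b M (near_crossing `&` [set w | J M w <= b + L.+1%:R]).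
    apply: (salgI (past_sigma b M)); first by apply: past_near_crossing => //; exact: ltW.
    by apply: measurable_wrt_le; apply: past_J => //; rewrite (le_trans N0)// ltW.
  refine (negligible_of_independent (past_complete b M)
    (@independent_barriers b M D1 D2 b0 hD1 iD1 hD2 iD2) KE mD _ _).
    by rewrite PD mule_gt0.
  have bad := negligibleU (negligibleU regular_ae gain) (negligibleU bD1 bD2).
  apply: negligibleS bad => w [[nw JL] [Dw1 Dw2]].
  have [gw|] := pselect (regular w); last by left; left.
  have [gA|] := pselect (A w -> 0 <= e * (Y (sigma w) w - Y (tau w) w)); last by left; right.
  have [w1|] := pselect (D1 w -> forall r, 0 <= r <= L.+1%:R ->
     eB * (B (b + r) w - B b w) <= - (c * r) + dl); last by right; left.
  have [w2|] := pselect (D2 w -> forall r, 0 <= r <= L.+1%:R ->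
     eW * (W (b + r) w - W b w) <= - (c * r) + dl); last by right; right.
  exfalso; apply: (near_crossing_stays gw gA nw) => u Nu uM.
  have [_ _ _ Jm _] := gw.
  have J1 := Jm _ _ N0 Nu; have J2 := Jm _ _ (le_trans N0 Nu) uM.
  have XE j : alpha * (j - J N w) + beta * (Z j w - Z (J N w) w) =
      (alpha * j + beta * Z j w) - X N w.
    by rewrite /subordinated !mulrBr opprD addrACA.
  have bdl : 0 <= `|beta| * dl by rewrite mulr_ge0// ltW.
  (* Up to [b] the bound from [near_level] is enough; beyond [b] the barriers are added to its value
     at [b]. *)
  have [jb|bj] := leP (J u w) b.
    have jb' : J N w <= J u w <= b by rewrite J1.
    have := near_crossing_move gw nw jb'; rewrite XE -/(X u w).
    by move: small bdl; move: (`|beta| * dl) => y; lra.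
  have Jb : J N w <= b <= b by rewrite lexx andbT; case: nw => [[[_ /ltW]]].
  have := near_crossing_move gw nw Jb; rewrite XE => hb.
  pose r := J u w - b.
  have r0 : 0 <= r by rewrite subr_ge0 ltW.
  have rL : 0 <= r <= L.+1%:R.
    by rewrite r0/= /r; move: JL J2; rewrite /=; lra.
  have hBr := w1 Dw1 _ rL; have hWr := w2 Dw2 _ rL.
  have br : b + r = J u w by rewrite /r addrC subrK.
  rewrite br in hBr hWr.
  have p1 : e * beta * rho * (B (J u w) w - B b w) <= `|beta * rho| * (- (c * r) + dl).
    by rewrite eBE mulrAC [leLHS]mulrC ler_wpM2l.
  have p2 : e * beta * s * (W (J u w) w - W b w) <= `|beta * s| * (- (c * r) + dl).
    by rewrite eWE mulrAC [leLHS]mulrC ler_wpM2l.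
  have p3 : e * alpha * r <= `|alpha| * r.
    rewrite ler_wpM2r//; apply: le_trans (ler_norm _) _.
    by rewrite normrM; case: e1 => ->; rewrite ?normrN normr1 mul1r.
  have q1 : `|beta * rho| + `|beta * s| <= 2 * `|beta|.
    rewrite !normrM (ger0_norm s0) -mulrDr mulrC ler_wpM2r//.
    have r1 : `|rho| <= 1 by rewrite ler_norml.
    have s1 : s <= 1 by have := sqr_ge0 rho; nra.
    by lra.
  have q2 : `|alpha| * r <= (`|beta * rho| + `|beta * s|) * (c * r).
    apply: le_trans (_ : c * `|beta| * r <= _); first by rewrite ler_wpM2r.
    rewrite mulrAC mulrC ler_wpM2r ?mulr_ge0// !normrM (ger0_norm s0) -mulrDr.
    by rewrite ler_peMr.
  have q3 : (`|beta * rho| + `|beta * s|) * dl <= 2 * (`|beta| * dl).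
    by rewrite mulrA ler_wpM2r// ltW.
  have -> : e * (X u w - X N w) =
      e * (alpha * b + beta * Z b w - X N w) + (e * alpha * r +
      e * beta * rho * (B (J u w) w - B b w) + e * beta * s * (W (J u w) w - W b w)).
    by rewrite /subordinated /correlated -/s /r; ring.
  move: hb p1 p2 p3 q2 q3 small {q1 hBr hWr br rL}.
  set x1 := e * (alpha * b + _ - _); set x2 := e * alpha * r.
  set x3 := e * beta * rho * _; set x4 := e * beta * s * _.
  move: x1 x2 x3 x4 (`|alpha| * (2 * h)) (`|alpha| * r) `|beta * rho| `|beta * s|.
  move: (`|beta| * dl) (c * r) => y cr x1 x2 x3 x4 ah ar p q.
  by move=> *; lra.
apply: negligibleS (negligible_bigcup Lneg) => w nw.
exists (Num.truncn (J M w - b)) => //; split=> //=.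
by rewrite -lerBlDl; apply/ltW/truncnS_gt.
Qed.

End AtTime.

(** A path with negative truncated gain lies in [near_crossing] for parameters from a countable
    family: [n] for the loss, [l] for the mesh, [k] for the cell of [J N], [i] for the bound on
    [T kap]. *)
Lemma truncated_gain_ge0 (N : R) : 0 <= N ->
  (forall M delta a h dl, N < M -> 0 <= a -> 0 < h -> 0 < dl ->
    `|alpha| * (2 * h) + 3 * (`|beta| * dl) < delta ->
    P.-negligible (near_crossing N M delta a h dl)) ->
  {ae P, forall w, A w ->
    0 <= e * (X (Num.min (T (sigma w) w) N) w - X (Num.min (T (tau w) w) N) w)}.
Proof.
move=> N0 null.
pose delta n : R := n.+1%:R^-1; pose h l : R := l.+1%:R^-1.
have delta0 n : 0 < delta n by rewrite invr_gt0.
have h0 l : 0 < h l by rewrite invr_gt0.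
(* Chosen so that the three [dl] terms use at most a quarter of [delta n]; the mesh chosen below
   uses at most half. *)
pose dl n := delta n / (12 * (`|beta| + 1)).
have c0 : 0 < 12 * (`|beta| + 1) by rewrite mulr_gt0// ltr_wpDl.
have dl0 n : 0 < dl n by rewrite divr_gt0.
have dlE n : 3 * (`|beta| * dl n) <= delta n / 4.
  have : dl n * (12 * (`|beta| + 1)) = delta n by rewrite divfK// gt_eqF.
  by have := dl0 n; move: (normr_ge0 beta); move: (dl n) => x; nra.
pose E n l k i := if `|alpha| * (2 * h l) + 3 * (`|beta| * dl n) < delta n then
  near_crossing N (N + i.+1%:R) (delta n) (k%:R * h l) (h l) (dl n) else set0.
have En n l k i : P.-negligible (E n l k i).
  rewrite /E; case: ifPn => [H|_]; last exact: negligible_set0.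
  by apply: null => //; [rewrite ltrDl|rewrite mulr_ge0// ltW].
have {}En : P.-negligible (\bigcup_n \bigcup_l \bigcup_k \bigcup_i E n l k i).
  by do 4 (apply: negligible_bigcup => ?).
apply: negligibleS (negligibleU (negligibleU regular_ae gain) En) => w /= nV.
have [gw|] := pselect (regular w); last by left; left.
have [gA|] := pselect (A w -> 0 <= e * (Y (sigma w) w - Y (tau w) w)); last by left; right.
right; have [_ _ _ Jm cw] := gw.
have [Aw Vneg] : A w /\
    e * (X (Num.min (T (sigma w) w) N) w - X (Num.min (T (tau w) w) N) w) < 0.
  by split; apply: contrapT => hn; apply: nV => Aw //; rewrite leNgt; apply/negP.
have Tts : T (tau w) w <= T (sigma w) w by exact: clock_le.
(* Were the position closed by then, the truncated gain would be the full one, which is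
   nonnegative. *)
have sN : N < T (sigma w) w.
  rewrite ltNge; apply/negP => sN; move: Vneg; apply/negP; rewrite -leNgt.
  by rewrite (min_idPl sN) (min_idPl (le_trans Tts sN)); exact: gA.
have tN : T (tau w) w < N.
  rewrite ltNge; apply/negP => tN; move: Vneg.
  by rewrite (min_idPr (ltW sN)) (min_idPr tN) subrr mulr0 ltxx.
rewrite (min_idPr (ltW sN)) (min_idPl (ltW tN)) in Vneg.
have gap : 0 < - (e * (X N w - X (T (tau w) w) w)) by rewrite oppr_gt0.
have [n _ Hn] := near_infty_natSinv_lt (PosNum gap).
have {}Hn := Hn n (leqnn n); rewrite -/(delta n) /= in Hn.
have J0 : 0 <= J N w by exact: J_ge0.
have [dd dd0 Hd] := Z_cont gw J0 (dl0 n).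
(* Levels between [J N] and [b] differ from [J N] by at most [2 * h l], hence the half of [dd]. *)
have q0 : 0 < Num.min (dd / 2) (delta n / (4 * (`|alpha| + 1))).
  by rewrite lt_min !divr_gt0// mulr_gt0// ltr_wpDl.
have [l _ Hl] := near_infty_natSinv_lt (PosNum q0).
have := Hl l (leqnn l); rewrite -/(h l) /= lt_min => /andP[hdd].
rewrite ltr_pdivlMr ?mulr_gt0 ?ltr_wpDl// => halpha.
pose k := Num.truncn (J N w / h l).
have /truncn_itv/andP[k1 k2] : 0 <= J N w / h l by rewrite divr_ge0// ltW.
rewrite -/k in k1 k2.
have {}k1 : k%:R * h l <= J N w by rewrite -ler_pdivlMr.
have {}k2 : J N w < k%:R * h l + h l.
  by rewrite -{2}[h l]mul1r -mulrDl natr1 -ltr_pdivrMr.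
exists n => //; exists l => //; exists k => //; exists (Num.truncn (T kap w - N)) => //.
rewrite /E ifT; last first.
  have := dlE n; have := normr_ge0 alpha; have := h0 l; have := delta0 n.
  by move: (h l) (delta n) halpha => x y; nra.
split=> //; split; last first.
  split=> // q /andP[_ qb] Jq; apply/ltW/Hd; first exact: le_trans Jq.
  by rewrite ger0_norm ?subr_ge0//; lra.
split; last by rewrite /=; have := h0 l; lra.
split; last by rewrite /= -lerBlDl; apply/ltW/truncnS_gt.
split; last by rewrite /= -lerNr; exact: ltW.
by split=> //; split=> //; exact: ltW.
Qed.

End Crossing.


(** * Use of no arbitrage for [X] *)

Hypothesis na : no_arbitrage P X (simple_strategies (time_changed_filtration P Y T)).

Let Gc t : 0 <= t -> complete_subalgebra P (time_changed_filtration P Y T t).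
Proof. by move=> t0; exact: (time_changed_complete Hc TH Tclock). Qed.

(** A buy-and-hold position of size [e]. It is applied with [beta = 0] and [e = alpha], when the
    gain is [alpha ^+ 2 * (J m - J 0)]. *)
Let constant_gain_eq0 (m e : R) : 0 <= m ->
  {ae P, forall w, 0 <= e * (X m w - X 0 w)} ->
  {ae P, forall w, e * (X m w - X 0 w) = 0}.
Proof.
move=> m0 pos; pose h := @Strategy _ Omega R 2 0 (fun _ _ => e)
  (fun j _ => if j == 1%N then 0 else m).
have st c : 0 <= c -> stopping_time (time_changed_filtration P Y T) (EFin \o (fun _ : Omega => c)).
  move=> c0; split=> // t t0; have [sG _ _] := Gc t0.
  rewrite (_ : [set _ | _] = [set w : Omega | c <= t])//.
  have [ct|ct] := leP c t.
    by rewrite (_ : [set _ | _] = setT); [exact: salgT|apply/seteqP; split].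
  by rewrite (_ : [set _ | _] = set0); [exact: salg0|apply/seteqP; split].
have hh : simple_strategies (time_changed_filtration P Y T) h.
  split=> //=.
  - by move=> w; split=> // -[//|[|//]].
  - by exists m.
  - by move=> j _; case: ifP => _; exact: st.
  - move=> j _; apply: measurable_wrt_cst.
    apply: (stopped_sigma_algebraP Gc (tau := EFin \o (fun _ : Omega => if j == 1%N then 0 else m))).
    by case: ifP => _; [case: (st 0 (lexx 0))|case: (st m m0)].
have gE : terminal_gain h X = fun w => e * (X m w - X 0 w).
  by apply/funext => w; rewrite /terminal_gain big_nat1.
have f0 : L0_nonneg P (terminal_gain h X).
  rewrite gE; split=> // _ C mC; rewrite setTI.
  apply: (measurable_wrtZ (K := measurable)) mC; first exact: sigma_algebra_measurable.
  by apply: measurable_wrtB; [exact: sigma_algebra_measurable|exact: mX|exact: mX].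
have fz : {ae P, forall w, terminal_gain h X w = 0}.
  by apply/(na f0); exists h => //; exact: aeW.
by apply: filterS fz => w; rewrite gE.
Qed.

Let P_J_null (m eta : R) : 0 <= m -> ~ (0 < P [set w | (J m w < eta)%R])%E ->
  {ae P, forall w, eta <= J m w}.
Proof.
move=> m0 /negP; rewrite -leNgt => P0.
have mJm : measurable [set w | J m w < eta] by apply: measurable_wrt_lt; exact: mJ.
have : P.-negligible [set w | J m w < eta].
  by apply/negligibleP => //; apply/eqP; rewrite eq_le P0 measure_ge0.
by apply: negligibleS => w /= /negP; rewrite -ltNge.
Qed.

Let not_ae_false : ~ {ae P, forall w : Omega, False}.
Proof.
move=> H; have : P.-negligible [set: Omega] by apply: negligibleS H => w _ [].
move=> nT; have P0 : P setT = 0%E by exact: measure_negligible.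
have PT : (0 < P setT)%E by rewrite probability_setT lte01.
by move: PT; rewrite P0 ltxx.
Qed.

(** If [J m >= eta] almost surely, stationarity gives every increment over a length [m] the same
    lower bound, so [J] passes any level by a deterministic time. *)
Let J_dichotomy :
  (forall m eta : R, 0 <= m -> 0 < eta -> (0 < P [set w | (J m w < eta)%R])%E) \/
  (exists2 c, 0 <= c /\ `|alpha| <= c * `|beta| & forall k : R, exists2 N1, 0 <= N1 &
     forall N, N1 <= N -> {ae P, forall w, k <= J N w}).
Proof.
have [slow|nslow] := pselect (forall m eta : R, 0 <= m -> 0 < eta ->
  (0 < P [set w | (J m w < eta)%R])%E); [by left|right].
have [m [eta [m0 eta0 Jeta]]] : exists m eta : R, [/\ 0 <= m, 0 < eta &
    {ae P, forall w, eta <= J m w}].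
  apply: contrapT => nJ; apply: nslow => m eta m0 eta0; apply: contrapT => Pn.
  by apply: nJ; exists m, eta; split=> //; exact: P_J_null.
have mgt0 : 0 < m.
  rewrite lt_neqAle m0 andbT; apply/eqP => m00; apply: not_ae_false.
  apply: filterS2 Jeta regular_ae => w + [_ _ [J0 _] _ _].
  by rewrite -m00 J0 leNgt eta0.
have Jn (n : nat) : {ae P, forall w, n%:R * eta <= J (n%:R * m) w}.
  elim: n => [|n IH].
    by apply: filterS regular_ae => w [_ _ [J0 _] _ _]; rewrite !mul0r J0.
  have nm0 : 0 <= n%:R * m by rewrite mulr_ge0.
  have nm1 : n%:R * m < n.+1%:R * m by rewrite ltr_pM2r// ltr_nat.
  have mincr : measurable_wrt measurable (fun w => J (n.+1%:R * m) w - J (n%:R * m) w).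
    apply: measurable_wrtB; first exact: sigma_algebra_measurable.
      by apply: mJ; exact: le_trans nm0 (ltW nm1).
    exact: mJ.
  have incr0 : {ae P, forall w, eta <= J (n.+1%:R * m) w - J (n%:R * m) w}.
    case: hJ => _ _ _ st.
    have := st _ _ nm0 nm1 `]-oo, eta[%classic (measurable_itv _).
    rewrite -mulrBl -natr1 addrAC subrr add0r mul1r.
    have Jm0 : P (J m @^-1` `]-oo, eta[%classic) = 0%E.
      apply: measure_negligible; first exact: (mJ m0 (measurable_itv _)).
      by apply: negligibleS Jeta => w /=; rewrite in_itv/= => Jw /le_lt_trans/(_ Jw); rewrite ltxx.
    rewrite Jm0 natr1 => incr_null.
    have : P.-negligible ((fun w => J (n.+1%:R * m) w - J (n%:R * m) w) @^-1` `]-oo, eta[%classic).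
      by apply/negligibleP => //; exact: (mincr _ (measurable_itv _)).
    by apply: negligibleS => w /= /negP; rewrite -ltNge in_itv.
  apply: filterS2 IH incr0 => w h1 h2.
  by rewrite -natr1 mulrDl mul1r natr1; lra.
have [c c0 ca] : exists2 c, 0 <= c & `|alpha| <= c * `|beta|.
  have [beta0|betaN0] := eqVneq beta 0; last first.
    exists (`|alpha| / `|beta|); first by rewrite divr_ge0.
    by rewrite divfK// normr_eq0.
  exists 0 => //; rewrite mul0r normr_le0; apply/eqP; apply: contrapT => /eqP alpha0.
  have XE w : alpha * (X m w - X 0 w) = alpha ^+ 2 * (J m w - J 0 w).
    by rewrite /subordinated beta0 !mul0r !addr0 -mulrBr mulrA.
  have pos : {ae P, forall w, 0 <= alpha * (X m w - X 0 w)}.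
    apply: filterS regular_ae => w [_ _ _ Jm _].
    by rewrite XE mulr_ge0 ?sqr_ge0// subr_ge0; exact: Jm.
  apply: not_ae_false.
  apply: filterS3 (constant_gain_eq0 m0 pos) Jeta regular_ae => w + Jw [_ _ [J0 _] _ _].
  rewrite XE J0 subr0 => /eqP; rewrite mulf_eq0 sqrf_eq0 (negbTE alpha0)/= => /eqP Jm0.
  by move: Jw; rewrite Jm0 leNgt eta0.
exists c => // k; pose n := (Num.truncn (k / eta)).+1.
exists (n%:R * m); first by rewrite mulr_ge0.
move=> N nN; apply: filterS2 (Jn n) regular_ae => w Jw [_ _ _ Jm _].
apply: le_trans (Jm _ _ _ nN); last by rewrite mulr_ge0.
by apply: le_trans Jw; rewrite -ler_pdivrMr//; apply/ltW/truncnS_gt.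
Qed.

Lemma one_step_free_exp : one_step_free P H (fun t w => expR (Y t w)).
Proof.
move=> tau sigma A e kap ht hs ts sk hA e1 gain.
have gainY : {ae P, forall w, A w -> 0 <= e * (Y (sigma w) w - Y (tau w) w)}.
  apply: filterS gain => w + Aw => /(_ Aw); case: e1 => ->.
    by rewrite !mul1r !subr_ge0 ler_expR.
  by rewrite !mulN1r !oppr_ge0 !subr_le0 ler_expR.
have [N1 N10 V0] : exists2 N1, 0 <= N1 & forall N, N1 <= N -> {ae P, forall w, A w ->
    0 <= e * (X (Num.min (T (sigma w) w) N) w - X (Num.min (T (tau w) w) N) w)}.
  have [slow|[c [c0 ca] fast]] := J_dichotomy.
    exists 0 => // N N0; apply: (truncated_gain_ge0 (kap := kap) ht ts gainY N0).
    by move=> M delta a h dl NM a0 h0 dl0 small; exact: (near_crossing_negligible_slow ht hs ts sk hA e1 gainY N0 NM a0 h0 dl0 small slow).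
  have [N1 N10 HN1] := fast (kap + 2).
  exists N1 => // N N1N; have N0 := le_trans N10 N1N.
  apply: (truncated_gain_ge0 (kap := kap) ht ts gainY N0).
  move=> M delta a h dl NM a0 h0 dl0 small.
  exact: (near_crossing_negligible_fast ht hs ts sk hA e1 gainY N0 NM a0 h0 dl0 small c0 ca (HN1 _ N1N)).
(* Countably many truncation times suffice: on each path some [N n] exceeds [T sigma], and
   truncation there changes nothing. *)
pose N n := N1 + n%:R.
have V00 n : {ae P, forall w, A w ->
    X (Num.min (T (sigma w) w) (N n)) w - X (Num.min (T (tau w) w) (N n)) w = 0}.
  apply: (truncated_gain_eq0 Hc Hmono TH Tclock na mX _ ht hs ts hA _ e1).
  - by apply: filterS regular_ae => w gw t t0; exact: X_right.
  - by rewrite addr_ge0.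
  - by apply: V0; rewrite lerDl.
have Vall := negligible_bigcup V00.
apply: negligibleS (negligibleU regular_ae Vall) => w /= nV.
have [gw|] := pselect (regular w); [right|by left].
apply: contrapT => nU; apply: nV => Aw.
have [tau0 _] := (stopping_timeP H tau).1 ht.
have [_ _ _ _ cw] := gw.
pose n := Num.truncn (T (sigma w) w).
have sN : T (sigma w) w <= N n.+1.
  by apply: le_trans (ltW (truncnS_gt _)) _; rewrite lerDr.
have tN : T (tau w) w <= N n.+1.
  by apply: le_trans sN; exact: clock_le.
have VE : X (Num.min (T (sigma w) w) (N n.+1)) w - X (Num.min (T (tau w) w) (N n.+1)) w = 0.
  by apply: contrapT => hn; apply: nU; exists n.+1 => // /(_ Aw).
rewrite (min_idPl sN) (min_idPl tN) in VE.
by rewrite /time_changed (subr0_eq VE) subrr.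
Qed.

Lemma no_arbitrage_exp_time_changed :
  no_arbitrage P (fun t w => expR (Y t w)) (simple_strategies H).
Proof.
apply: (no_arbitrage_of_one_step Hc Hmono) one_step_free_exp.
- move=> t t0; apply: (measurable_wrt_comp (h := expR)); last exact: YH.
  exact: measurable_expR.
- apply: filterS regular_ae => w gw t t0.
  by apply: right_continuous_at_expR; exact: Y_right.
Qed.

End Core.

(** * The model with an integrated clock *)

Theorem theorem4p4 (d : measure_display) (Omega : measurableType d)
    (R : realType) (P : probability Omega R)
    (F : R -> set (set Omega)) (B W J : R -> Omega -> R)
    (rho alpha beta : R) (mu sigma : R -> R -> R) (v : R -> Omega -> R)
    (T := time_change v)
    (X := subordinated alpha beta (correlated rho B W) J)
    (Y := time_changed X T) :
  filtration F -> usual_conditions P F ->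
  brownian_motion P F B -> brownian_motion P F W ->
  independent P (all_events B) (all_events W) ->
  adapted F J -> levy_process P J -> nondecreasing_paths P J ->
  independent P (all_events J) (all_events B `|` all_events W) ->
  -1 <= rho <= 1 ->
  unique_strong_solution P B mu sigma v ->
  {ae P, forall w, forall t, 0 <= t -> 0 <= v t w} ->
  (forall t, 0 <= t -> expectation P (T t) = t%:E) ->
  {ae P, forall w, T t w @[t --> +oo] --> +oo} ->
  {ae P, forall w, forall s t, 0 <= s -> s < t -> T s w < T t w} ->
  no_arbitrage P X (simple_strategies (time_changed_filtration P Y T)) ->
  no_arbitrage P (fun t w => expR (Y t w))
    (simple_strategies (natural_filtration2 P Y T)).
Proof.
move=> hF [F0 _] hB hW hBW hJF hJ hJm hJBW hrho [[va vc _ _] _] v0 _ _ Tinc na.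
have null_measurable N : P.-negligible N -> measurable N.
  by case: hF => _ Fm _ /F0; exact: Fm.
have mB t : 0 <= t -> measurable_wrt measurable (B t).
  by case: hF => _ Fm _ t0; apply: measurable_wrtS (Fm _ t0) _; case: hB => aB _ _ _ _; exact: aB.
(* The strong solution [v] is adapted to the filtration of [B], and so is its integral; this is what
   ties the clock up to [kap] to [B] alone. *)
have TB : adapted (natural_filtration P B) T.
  move=> t t0; apply: (measurable_wrt_time_change (P := P)) => //.
    by apply: complete_augmentation => // s _; exact: past_events_measurable.
  move=> s s0 st; apply: measurable_wrtS (va _ s0).
  exact: augmentation_mono.
have Tclock : {ae P, forall w, clock T w}.
  apply: filterS2 vc Tinc => w cw inc; split=> //.
    exact: continuous_pos_Rintegral.
  by rewrite /T /time_change set_itv1 Rintegral_set1.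
exact: (no_arbitrage_exp_time_changed hF F0 hB hW hBW hJF hJ hJm hJBW hrho TB Tclock na).
Qed.
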